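(* Let $(S,\mathfrak n)$ be a commutative noetherian local ring, let $\omega\in\mathfrak n$ be a non-zerodivisor, and let $R=S/(\omega)$. Then there is a fully faithful triangle functor $\underline{T}:\underline{\mathcal G}(R)\longrightarrow\underline{\mathsf{Mon}}(\omega,\mathcal G)$.
   Context: All modules are finitely generated. For a commutative noetherian ring $A$, a finitely generated $A$-module $M$ is Gorenstein projective if $\mathrm{Ext}^i_A(M,A)=0=\mathrm{Ext}^i_A(\mathrm{Hom}_A(M,A),A)$ for all $i\ge 1$ and the biduality map $M\to \mathrm{Hom}_A(\mathrm{Hom}_A(M,A),A)$ is an isomorphism; $\mathcal G(A)$ is the category of finitely generated Gorenstein projective $A$-modules. It is a Frobenius category with the usual short exact sequences as conflations, its projective-injective objects being the finitely generated projective $A$-modules; its stable category is $\underline{\mathcal G}(A)$. $\mathsf{Mon}(\omega,\mathcal G)$ is the category whose objects are the injective $S$-homomorphisms $(G_1\xrightarrow{f}G_0)$ with $G_1,G_0\in\mathcal G(S)$ and $\omega\,\mathrm{Coker} f=0$; morphisms $(G_1\xrightarrow{f}G_0)\to(G'_1\xrightarrow{f'}G'_0)$ are pairs $(\varphi_1,\varphi_0)$ of $S$-homomorphisms $\varphi_i:G_i\to G_i'$ with $f'\varphi_1=\varphi_0 f$. It is an exact category with the componentwise short exact sequences with terms in $\mathsf{Mon}(\omega,\mathcal G)$ as conflations, and it is a Frobenius category (enough projectives and injectives, which coincide); its stable category is $\underline{\mathsf{Mon}}(\omega,\mathcal G)$. The stable category $\underline{\mathcal F}$ of a Frobenius category $\mathcal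 F$ has the same objects, with morphisms taken modulo those factoring through projective objects; it carries Happel's triangulated structure, with shift the inverse syzygy and distinguished triangles induced by conflations. A triangle functor is an additive functor commuting with shifts up to natural isomorphism and preserving distinguished triangles. *)

(* Defs.v *)
From HB Require Import structures.
From mathcomp Require Import all_boot all_algebra.
From mathcomp Require Import boolp classical_sets.

Set Implicit Arguments.
Unset Strict Implicit.
Unset Printing Implicit Defensive.

Import GRing.Theory.
Local Open Scope ring_scope.

Definition is_ideal (A : comNzRingType) (I : set A) : Prop :=
  [/\ I 0, (forall x y, I x -> I y -> I (x + y))
    & (forall a x, I x -> I (a * x))].

Definition noetherian (A : comNzRingType) : Prop :=
  forall I : set A, is_ideal I ->
    exists (n : nat) (e : 'I_n -> A),
      forall x, I x <-> exists c : 'I_n -> A, x = \sum_i c i * e i.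

Definition maximal_ideal (A : comNzRingType) (I : set A) : Prop :=
  [/\ is_ideal I, ~ I 1
    & forall J : set A, is_ideal J -> ~ J 1 ->
        (forall x, I x -> J x) -> (forall x, J x -> I x)].

Definition local_ring (A : comNzRingType) (n : set A) : Prop :=
  maximal_ideal n /\ forall m : set A, maximal_ideal m -> m = n.

Definition nonzerodivisor (A : comNzRingType) (w : A) : Prop :=
  forall x, w * x = 0 -> x = 0.

(* The properness proof is an argument only so that the ideal quotient, which
   the library forms for proper ideals, can be inferred. *)
Definition principal_ideal (A : comNzRingType) (w : A)
    (proper : ~ exists a, 1 = a * w) : {pred A} :=
  fun x => `[< exists a, x = a * w >].

Lemma principal_ideal_closed (A : comNzRingType) (w : A)
    (proper : ~ exists a, 1 = a * w) : idealr_closed (principal_ideal proper).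
Proof.
split.
- by apply/asboolP; exists 0; rewrite mul0r.
- by apply/asboolP.
- move=> a _ _ /asboolP[b ->] /asboolP[c ->].
  by apply/asboolP; exists (a * b + c); rewrite mulrDl mulrA.
Qed.

HB.instance Definition _ (A : comNzRingType) (w : A)
    (proper : ~ exists a, 1 = a * w) :=
  isIdealr.Build A (principal_ideal proper) (principal_ideal_closed proper).

Lemma local_proper (A : comNzRingType) (n : set A) (w : A) :
  local_ring n -> n w -> ~ exists a, 1 = a * w.
Proof.
by move=> [[[_ _ nM] n1 _] _] nw [a e]; apply: n1; rewrite e; apply: nM.
Qed.

Definition quotient_ring (S : comNzRingType) (n : set S) (w : S)
    (Sloc : local_ring n) (nw : n w) : comNzRingType :=
  {ideal_quot (principal_ideal (local_proper Sloc nw))}.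

Definition linHom (A : comNzRingType) (M N : lmodType A) : Type :=
  {linear M -> N}.

Section LinHom.
Variables (A : comNzRingType) (M N : lmodType A).
Implicit Types f g h : linHom M N.

HB.instance Definition _ := gen_eqMixin (linHom M N).
HB.instance Definition _ := gen_choiceMixin (linHom M N).

Definition lin_fun f : M -> N := (f : {linear M -> N}).

Lemma linHomP f g : (forall x, lin_fun f x = lin_fun g x) -> f = g.
Proof.
case: f g => [f [[f1] [f2]]] [g [[g1] [g2]]] /= e.
have {}e : f = g by apply/funext; exact: e.
by subst g; rewrite (Prop_irrelevance f1 g1) (Prop_irrelevance f2 g2).
Qed.

Definition lin_zero : linHom M N := (\0 : {linear M -> N}).
Definition lin_opp f : linHom M N := (\- lin_fun f : {linear M -> N}).
Definition lin_add f g : linHom M N :=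
  (lin_fun f \+ lin_fun g : {linear M -> N}).
Definition lin_scale (a : A) f : linHom M N := (a \*: lin_fun f : {linear M -> N}).


Lemma lin_addA : associative lin_add.
Proof. by move=> f g h; apply: linHomP => x; exact: addrA. Qed.
Lemma lin_addC : commutative lin_add.
Proof. by move=> f g; apply: linHomP => x; exact: addrC. Qed.
Lemma lin_add0 : left_id lin_zero lin_add.
Proof. by move=> f; apply: linHomP => x; exact: add0r. Qed.
Lemma lin_addN : left_inverse lin_zero lin_opp lin_add.
Proof. by move=> f; apply: linHomP => x; exact: addNr. Qed.

HB.instance Definition _ :=
  GRing.isZmodule.Build (linHom M N) lin_addA lin_addC lin_add0 lin_addN.

Lemma lin_scaleA a b f : lin_scale a (lin_scale b f) = lin_scale (a * b) f.
Proof. by apply: linHomP => x; exact: scalerA. Qed.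
Lemma lin_scale1 : left_id 1 lin_scale.
Proof. by move=> f; apply: linHomP => x; exact: scale1r. Qed.
Lemma lin_scaleDr : right_distributive lin_scale +%R.
Proof. by move=> a f g; apply: linHomP => x; exact: scalerDr. Qed.
Lemma lin_scaleDl f : {morph lin_scale^~ f : a b / a + b}.
Proof. by move=> a b; apply: linHomP => x; exact: scalerDl. Qed.

HB.instance Definition _ := GRing.Zmodule_isLmodule.Build A (linHom M N)
  lin_scaleA lin_scale1 lin_scaleDr lin_scaleDl.

End LinHom.

Definition dual (A : comNzRingType) (M : lmodType A) : lmodType A :=
  linHom M (A^o : lmodType A).

Section Biduality.
Variables (A : comNzRingType) (M : lmodType A).

Definition eval_at (x : M) (f : dual M) : A^o := lin_fun f x.

Lemma eval_at_linear x : linear (eval_at x).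
Proof. by []. Qed.

HB.instance Definition _ x :=
  GRing.isLinear.Build A (dual M) A^o _ (eval_at x) (eval_at_linear x).

Definition biduality (x : M) : dual (dual M) :=
  (eval_at x : {linear dual M -> A^o}).

End Biduality.

Definition exact_at (X Y Z : Type) (z : Z) (f : X -> Y) (g : Y -> Z) : Prop :=
  forall y, g y = z <-> exists x, f x = y.

Definition short_exact (A : comNzRingType) (X Y Z : lmodType A)
    (f : X -> Y) (g : Y -> Z) : Prop :=
  [/\ injective f, exact_at 0 f g & forall z, exists y, g y = z].

Definition projective_module (A : comNzRingType) (P : lmodType A) : Prop :=
  forall (M N : lmodType A) (g : {linear M -> N}) (h : {linear P -> N}),
    (forall y, exists x, g x = y) ->
    exists k : {linear P -> M}, forall x, g (k x) = h x.

Record proj_resolution (A : comNzRingType) (M : lmodType A) := ProjResolution {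
  res_obj :> nat -> lmodType A;
  res_d : forall i, {linear res_obj i.+1 -> res_obj i};
  res_aug : {linear res_obj 0 -> M};
  res_projective : forall i, projective_module (res_obj i);
  res_exact : forall i, exact_at 0 (res_d i.+1) (res_d i);
  res_exact0 : exact_at 0 (res_d 0) res_aug;
  res_aug_surj : forall y, exists x, res_aug x = y
}.

Definition is_coboundary (A : comNzRingType) (M N : lmodType A)
    (P : proj_resolution M) (i : nat) : {linear P i -> N} -> Prop :=
  match i with
  | 0 => fun phi => forall x, phi x = 0
  | j.+1 => fun phi =>
      exists psi : {linear P j -> N}, forall x, phi x = psi (res_d P j x)
  end.

(* Ext^i_A(M, N) = 0: the complex Hom_A(P, N) has no cohomology in degree i,
   P being a projective resolution of M (any one, as Ext does not depend on
   it). *)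
Definition Ext_vanishes (A : comNzRingType) (i : nat) (M N : lmodType A)
    : Prop :=
  forall (P : proj_resolution M) (phi : {linear P i -> N}),
    (forall x, phi (res_d P i x) = 0) -> is_coboundary phi.

Definition finitely_generated (A : comNzRingType) (M : lmodType A) : Prop :=
  exists (n : nat) (e : 'I_n -> M),
    forall x, exists c : 'I_n -> A, x = \sum_i c i *: e i.

Definition gorenstein_projective (A : comNzRingType) (M : lmodType A) : Prop :=
  [/\ forall i, (0 < i)%N -> Ext_vanishes i M A^o,
      forall i, (0 < i)%N -> Ext_vanishes i (dual M) A^o
    & bijective (@biduality A M)].

(* Only the data and the preadditive laws are recorded: the exact and Frobenius
   axioms play no role in the definitions below. *)
Record confCat := ConfCat {
  obj :> Type;
  hom : obj -> obj -> zmodType;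
  idm : forall X, hom X X;
  comp : forall X Y Z, hom Y Z -> hom X Y -> hom X Z;
  comp1m : forall X Y (f : hom X Y), comp (idm Y) f = f;
  compm1 : forall X Y (f : hom X Y), comp f (idm X) = f;
  compA : forall X Y Z W (h : hom Z W) (g : hom Y Z) (f : hom X Y),
    comp h (comp g f) = comp (comp h g) f;
  compDl : forall X Y Z (g g' : hom Y Z) (f : hom X Y),
    comp (g + g') f = comp g f + comp g' f;
  compDr : forall X Y Z (g : hom Y Z) (f f' : hom X Y),
    comp g (f + f') = comp g f + comp g f';
  conflation : forall X Y Z, hom X Y -> hom Y Z -> Prop
}.

Arguments hom {c} X Y.
Arguments idm {c} X.
Arguments comp {c X Y Z}.
Arguments conflation {c X Y Z}.

Notation "g \oc f" := (comp g f) (at level 40, left associativity).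

Section Stable.
Variable C : confCat.

Definition projective (P : C) : Prop :=
  forall (X Y Z : C) (u : hom X Y) (v : hom Y Z), conflation u v ->
    forall h : hom P Z, exists k : hom P Y, v \oc k = h.

Definition injective_obj (I : C) : Prop :=
  forall (X Y Z : C) (u : hom X Y) (v : hom Y Z), conflation u v ->
    forall h : hom X I, exists k : hom Y I, k \oc u = h.

(* Equality of morphisms in the stable category, whose Hom-groups are the
   hom X Y with this equality. *)
Definition stable_eq (X Y : C) (f g : hom X Y) : Prop :=
  exists P : C, projective P /\
    exists (a : hom X P) (b : hom P Y), f - g = b \oc a.

Definition stable_iso (X Y : C) (f : hom X Y) : Prop :=
  exists g : hom Y X,
    stable_eq (g \oc f) (idm X) /\ stable_eq (f \oc g) (idm Y).

(* A choice, for every X, of a conflation X -> I X -> shift X with I X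
   projective-injective, and, for every f, of a morphism induced by f; these
   are the choices on which Happel's shift functor depends. *)
Record happel_shift := HappelShift {
  hull : C -> C;
  shift : C -> C;
  hull_in : forall X, hom X (hull X);
  hull_out : forall X, hom (hull X) (shift X);
  hull_conflation : forall X, conflation (hull_in X) (hull_out X);
  hull_projective : forall X, projective (hull X);
  hull_injective : forall X, injective_obj (hull X);
  shift_map : forall X Y, hom X Y -> hom (shift X) (shift Y);
  shift_mapP : forall X Y (f : hom X Y),
    exists h : hom (hull X) (hull Y),
      h \oc hull_in X = hull_in Y \oc f /\
      shift_map f \oc hull_out X = hull_out Y \oc h
}.

Variable s : happel_shift.

(* The triangle induced by a conflation (u, v).  The sign is the one making it
   isomorphic to Happel's triangle on the pushout of hull_in X and u. *)
Definition conflation_triangle (X Y Z : C)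
    (u : hom X Y) (v : hom Y Z) (w : hom Z (shift s X)) : Prop :=
  conflation u v /\
  exists h : hom Y (hull s X),
    h \oc u = hull_in s X /\ w \oc v = - (hull_out s X \oc h).

Definition distinguished (X Y Z : C)
    (u : hom X Y) (v : hom Y Z) (w : hom Z (shift s X)) : Prop :=
  exists (X' Y' Z' : C) (u' : hom X' Y') (v' : hom Y' Z')
         (w' : hom Z' (shift s X')),
    conflation_triangle u' v' w' /\
    exists (a : hom X X') (b : hom Y Y') (c : hom Z Z'),
      [/\ stable_iso a, stable_iso b & stable_iso c] /\
      [/\ stable_eq (b \oc u) (u' \oc a),
          stable_eq (c \oc v) (v' \oc b)
        & stable_eq (shift_map s a \oc w) (w' \oc c)].

End Stable.

Arguments shift_map {C} h {X Y}.

(* A triangle functor between the stable categories of C and D, with the shifts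
   sC and sD; a functor on stable Hom-groups is given on representatives. *)
Record triangle_functor (C D : confCat) (sC : happel_shift C)
    (sD : happel_shift D) := TriangleFunctor {
  tf_obj :> C -> D;
  tf_map : forall X Y : C, hom X Y -> hom (tf_obj X) (tf_obj Y);
  tf_map_eq : forall (X Y : C) (f g : hom X Y),
    stable_eq f g -> stable_eq (tf_map f) (tf_map g);
  tf_map_id : forall X : C, stable_eq (tf_map (idm X)) (idm (tf_obj X));
  tf_map_comp : forall (X Y Z : C) (g : hom Y Z) (f : hom X Y),
    stable_eq (tf_map (g \oc f)) (tf_map g \oc tf_map f);
  tf_map_add : forall (X Y : C) (f g : hom X Y),
    stable_eq (tf_map (f + g)) (tf_map f + tf_map g);
  tf_shift : forall X : C, hom (tf_obj (shift sC X)) (shift sD (tf_obj X));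
  tf_shift_iso : forall X : C, stable_iso (tf_shift X);
  tf_shift_natural : forall (X Y : C) (f : hom X Y),
    stable_eq (tf_shift Y \oc tf_map (shift_map sC f))
              (shift_map sD (tf_map f) \oc tf_shift X);
  tf_distinguished : forall (X Y Z : C) (u : hom X Y) (v : hom Y Z)
      (w : hom Z (shift sC X)),
    distinguished u v w ->
    distinguished (tf_map u) (tf_map v) (tf_shift X \oc tf_map w)
}.

Definition fully_faithful (C D : confCat) (sC : happel_shift C)
    (sD : happel_shift D) (F : triangle_functor sC sD) : Prop :=
  forall X Y : C,
    (forall f g : hom X Y,
       stable_eq (tf_map F f) (tf_map F g) -> stable_eq f g) /\
    (forall h : hom (F X) (F Y), exists f : hom X Y, stable_eq (tf_map F f) h).

Record gproj (A : comNzRingType) := Gproj {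
  gmod :> lmodType A;
  gmod_fg : finitely_generated gmod;
  gmod_gp : gorenstein_projective gmod
}.

Section GprojCat.
Variable A : comNzRingType.

Definition lin_id (M : lmodType A) : linHom M M := (idfun : {linear M -> M}).
Definition lin_comp (M N P : lmodType A) (g : linHom N P) (f : linHom M N)
    : linHom M P :=
  ((g : {linear N -> P}) \o (f : {linear M -> N}) : {linear M -> P}).

Lemma lin_comp1m (M N : lmodType A) (f : linHom M N) :
  lin_comp (lin_id N) f = f.
Proof. exact: linHomP. Qed.
Lemma lin_compm1 (M N : lmodType A) (f : linHom M N) :
  lin_comp f (lin_id M) = f.
Proof. exact: linHomP. Qed.
Lemma lin_compA (M N P Q : lmodType A) (h : linHom P Q) (g : linHom N P)
    (f : linHom M N) : lin_comp h (lin_comp g f) = lin_comp (lin_comp h g) f.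
Proof. exact: linHomP. Qed.
Lemma lin_compDl (M N P : lmodType A) (g g' : linHom N P) (f : linHom M N) :
  lin_comp (g + g') f = lin_comp g f + lin_comp g' f.
Proof. exact: linHomP. Qed.
Lemma lin_compDr (M N P : lmodType A) (g : linHom N P) (f f' : linHom M N) :
  lin_comp g (f + f') = lin_comp g f + lin_comp g f'.
Proof.
by apply: linHomP => x; exact: (linearD (g : {linear N -> P})).
Qed.

Definition GprojCat : confCat := @ConfCat (gproj A)
  (fun M N => linHom M N) (fun M => lin_id M)
  (fun M N P => @lin_comp M N P)
  (fun M N => @lin_comp1m M N) (fun M N => @lin_compm1 M N)
  (fun M N P Q => @lin_compA M N P Q)
  (fun M N P => @lin_compDl M N P) (fun M N P => @lin_compDr M N P)
  (fun M N P u v => short_exact (lin_fun u) (lin_fun v)).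

End GprojCat.

Record mon (S : comNzRingType) (w : S) := Mon {
  mon1 : gproj S;
  mon0 : gproj S;
  mon_map : linHom mon1 mon0;
  mon_inj : injective (lin_fun mon_map);
  (* w annihilates the cokernel of mon_map *)
  mon_coker : forall y : mon0, exists x : mon1, lin_fun mon_map x = w *: y
}.

Section MonHom.
Variables (S : comNzRingType) (w : S) (X Y : mon w).

Record monHom := MonHom {
  mh1 : linHom (mon1 X) (mon1 Y);
  mh0 : linHom (mon0 X) (mon0 Y);
  mh_comm : lin_comp (mon_map Y) mh1 = lin_comp mh0 (mon_map X)
}.

Lemma monHomP (f g : monHom) : mh1 f = mh1 g -> mh0 f = mh0 g -> f = g.
Proof.
case: f g => [f1 f0 fc] [g1 g0 gc] /= e1 e0; subst g1 g0.
by rewrite (Prop_irrelevance fc gc).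
Qed.

HB.instance Definition _ := gen_eqMixin monHom.
HB.instance Definition _ := gen_choiceMixin monHom.

Lemma mh_zero_comm : lin_comp (mon_map Y) 0 = lin_comp 0 (mon_map X).
Proof.
by apply: linHomP => x; exact: (linear0 (mon_map Y : {linear _ -> _})).
Qed.
Lemma mh_opp_comm (f : monHom) :
  lin_comp (mon_map Y) (- mh1 f) = lin_comp (- mh0 f) (mon_map X).
Proof.
apply: linHomP => x.
rewrite [LHS](linearN (mon_map Y : {linear _ -> _})); congr (- _).
exact: (congr1 (fun h => lin_fun h x) (mh_comm f)).
Qed.
Lemma mh_add_comm (f g : monHom) :
  lin_comp (mon_map Y) (mh1 f + mh1 g) = lin_comp (mh0 f + mh0 g) (mon_map X).
Proof. by rewrite lin_compDl lin_compDr !mh_comm. Qed.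

Definition mh_zero := MonHom mh_zero_comm.
Definition mh_opp f := MonHom (mh_opp_comm f).
Definition mh_add f g := MonHom (mh_add_comm f g).

Lemma mh_addA : associative mh_add.
Proof. by move=> f g h; apply: monHomP; exact: addrA. Qed.
Lemma mh_addC : commutative mh_add.
Proof. by move=> f g; apply: monHomP; exact: addrC. Qed.
Lemma mh_add0 : left_id mh_zero mh_add.
Proof. by move=> f; apply: monHomP; exact: add0r. Qed.
Lemma mh_addN : left_inverse mh_zero mh_opp mh_add.
Proof. by move=> f; apply: monHomP; exact: addNr. Qed.

HB.instance Definition _ :=
  GRing.isZmodule.Build monHom mh_addA mh_addC mh_add0 mh_addN.

End MonHom.

Section MonCat.
Variables (S : comNzRingType) (w : S).
Implicit Types X Y Z W : mon w.

Definition mh_id X : monHom X X :=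
  @MonHom _ _ X X (lin_id _) (lin_id _)
    (etrans (lin_compm1 _) (esym (lin_comp1m _))).

Lemma mh_comp_comm X Y Z (g : monHom Y Z) (f : monHom X Y) :
  lin_comp (mon_map Z) (lin_comp (mh1 g) (mh1 f)) =
  lin_comp (lin_comp (mh0 g) (mh0 f)) (mon_map X).
Proof. by rewrite lin_compA mh_comm -!lin_compA mh_comm. Qed.

Definition mh_comp X Y Z (g : monHom Y Z) (f : monHom X Y) : monHom X Z :=
  MonHom (mh_comp_comm g f).

Lemma mh_comp1m X Y (f : monHom X Y) : mh_comp (mh_id Y) f = f.
Proof. by apply: monHomP; exact: lin_comp1m. Qed.
Lemma mh_compm1 X Y (f : monHom X Y) : mh_comp f (mh_id X) = f.
Proof. by apply: monHomP; exact: lin_compm1. Qed.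
Lemma mh_compA X Y Z W (h : monHom Z W) (g : monHom Y Z) (f : monHom X Y) :
  mh_comp h (mh_comp g f) = mh_comp (mh_comp h g) f.
Proof. by apply: monHomP; exact: lin_compA. Qed.
Lemma mh_compDl X Y Z (g g' : monHom Y Z) (f : monHom X Y) :
  mh_comp (g + g') f = mh_comp g f + mh_comp g' f.
Proof. by apply: monHomP; exact: lin_compDl. Qed.
Lemma mh_compDr X Y Z (g : monHom Y Z) (f f' : monHom X Y) :
  mh_comp g (f + f') = mh_comp g f + mh_comp g f'.
Proof. by apply: monHomP; exact: lin_compDr. Qed.

Definition MonCat : confCat := @ConfCat (mon w)
  (fun X Y => monHom X Y) mh_id mh_comp mh_comp1m mh_compm1 mh_compA
  mh_compDl mh_compDr
  (fun X Y Z u v =>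
     short_exact (lin_fun (mh1 u)) (lin_fun (mh1 v)) /\
     short_exact (lin_fun (mh0 u)) (lin_fun (mh0 v))).

End MonCat.

(* Main.v *)
From HB Require Import structures.
Require Import Defs.
From mathcomp Require Import all_boot all_algebra.
From mathcomp Require Import boolp classical_sets.
(* Imported again because MathComp shadows [hom]. *)
Require Import Defs.

(* Write a Gorenstein projective R-module M as R^n / L.  The kernel K of the
   composite S^n -> R^n -> M is Gorenstein projective over S, so that K -> S^n is
   an object of Mon with cokernel M; this is T M.  Morphisms of cokernels lift to
   Mon because S^n is free, and a morphism inducing 0 on cokernels factors through
   the projective object S^n = S^n.  The projective objects of Mon are the
   retracts of sums of copies of S = S and w : S -> S, whose cokernels are free
   over R, so the stable Hom-groups of both sides agree.  The horseshoe lemma turns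
   conflations over R into conflations of Mon, which gives the comparison of
   shifts and the preservation of triangles.

   Let L be the kernel of R^n -> M.  Multiplication by w gives S^n -> K, and a
   free cover R^m -> L lifts to S^m -> K; together they map S^n + S^m onto K, and
   the kernel is the kernel of S^m -> R^m -> L.  So the modules K, for varying n
   and M, are closed under syzygies; functionals extend along these syzygies since
   Ext^1_R(M, R) = 0.  The dual of K is again of this form, for the dual of L. *)

Set Implicit Arguments.
Unset Strict Implicit.
Unset Printing Implicit Defensive.

Import GRing.Theory.
Local Open Scope ring_scope.

(** * Stable categories of Frobenius categories *)

(** Presentations are chosen, and lifts of a morphism agree only up to maps through projectives, so
    the chosen lifts compose and add only stably. The formal half therefore works with the relation
    of inducing a given morphism on presented objects, and reduces each identity to uniqueness of
    lifts in the stable category.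

    Functionals pass between [S] and [R] by reduction, by lifting, and by division by [w]: a
    functional with values in [wS] is divided by the non-zerodivisor [w]. Extension of functionals
    and reflexivity over [S] are both obtained from those over [R] in this way.

    In Mon a hull costs more than a cover. The componentwise cokernels of an embedding must again
    form a monomorphism, and this rests on Gorenstein projective modules having no [w]-torsion. *)

Section Additive.
Variable C : confCat.

Lemma comp0m (X Y Z : C) (f : hom X Y) : (0 : hom Y Z) \oc f = 0.
Proof. by apply: (addIr (0 \oc f)); rewrite -compDl !add0r. Qed.

Lemma compm0 (X Y Z : C) (g : hom Y Z) : g \oc (0 : hom X Y) = 0.
Proof. by apply: (addIr (g \oc 0)); rewrite -compDr !add0r. Qed.

Lemma compNm (X Y Z : C) (g : hom Y Z) (f : hom X Y) : (- g) \oc f = - (g \oc f).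
Proof. by apply: (addIr (g \oc f)); rewrite -compDl !addNr comp0m. Qed.

Lemma compmN (X Y Z : C) (g : hom Y Z) (f : hom X Y) : g \oc (- f) = - (g \oc f).
Proof. by apply: (addIr (g \oc f)); rewrite -compDr !addNr compm0. Qed.

Lemma compBl (X Y Z : C) (g g' : hom Y Z) (f : hom X Y) :
  (g - g') \oc f = g \oc f - g' \oc f.
Proof. by rewrite compDl compNm. Qed.

Lemma compBr (X Y Z : C) (g : hom Y Z) (f f' : hom X Y) :
  g \oc (f - f') = g \oc f - g \oc f'.
Proof. by rewrite compDr compmN. Qed.

Lemma retract_projective (X P : C) (s : hom X P) (r : hom P X) :
  r \oc s = idm X -> projective P -> projective X.
Proof.
move=> rs pP A B Z u v uv h; have [k kh] := pP _ _ _ _ _ uv (h \oc r).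
by exists (k \oc s); rewrite compA kh -compA rs compm1.
Qed.

Lemma retract_injective (X I : C) (s : hom X I) (r : hom I X) :
  r \oc s = idm X -> injective_obj I -> injective_obj X.
Proof.
move=> rs iI A B Z u v uv h; have [k kh] := iI _ _ _ _ _ uv (s \oc h).
by exists (r \oc k); rewrite -compA kh compA rs comp1m.
Qed.

End Additive.

Record frobenius_like (C : confCat) : Prop := FrobeniusLike {
  confl_comp : forall (X Y Z : C) (u : hom X Y) (v : hom Y Z),
    conflation u v -> v \oc u = 0;
  confl_epi : forall (X Y Z W : C) (u : hom X Y) (v : hom Y Z) (g : hom Z W),
    conflation u v -> g \oc v = 0 -> g = 0;
  confl_coker : forall (X Y Z W : C) (u : hom X Y) (v : hom Y Z) (g : hom Y W),
    conflation u v -> g \oc u = 0 -> exists g' : hom Z W, g' \oc v = g;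
  projective_injective : forall P : C, projective P -> injective_obj P;
  enough_injectives : forall X : C, exists (I Z : C) (u : hom X I) (v : hom I Z),
    conflation u v /\ projective I
}.

Section StableFrobenius.
Variable C : confCat.
Hypothesis CF : frobenius_like C.

Lemma frobenius_happel_shift : inhabited (happel_shift C).
Proof.
pose I X := sval (cid (enough_injectives CF X)).
pose Z X := sval (cid (svalP (cid (enough_injectives CF X)))).
have uvE X : exists uv : hom X (I X) * hom (I X) (Z X),
    conflation uv.1 uv.2 /\ projective (I X).
  have [u [v uvP]] := svalP (cid (svalP (cid (enough_injectives CF X)))).
  by exists (u, v).
pose u X := (sval (cid (uvE X))).1; pose v X := (sval (cid (uvE X))).2.
have uvP X : conflation (u X) (v X) /\ projective (I X) := svalP (cid (uvE X)).
have ex X Y (f : hom X Y) : exists sf : hom (Z X) (Z Y),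
    exists h : hom (I X) (I Y), h \oc u X = u Y \oc f /\ sf \oc v X = v Y \oc h.
  have [cX pX] := uvP X; have [cY pY] := uvP Y.
  have [h hE] := projective_injective CF pY cX (u Y \oc f).
  have [|sf sfE] := confl_coker CF (g := v Y \oc h) cX.
    by rewrite -compA hE compA (confl_comp CF cY) comp0m.
  by exists sf, h.
constructor; apply: (@HappelShift C I Z u v _ _ _
  (fun X Y f => sval (cid (ex X Y f)))).
- by move=> X; case: (uvP X).
- by move=> X; case: (uvP X).
- by move=> X; apply: projective_injective => //; case: (uvP X).
- by move=> X Y f; case: cid.
Qed.

(* A morphism factoring through some projective factors through any conflation
   into a projective, which makes the stably zero morphisms a subgroup without
   using biproducts. *)
Lemma stable_eqP (X I Z : C) (u : hom X I) (v : hom I Z) :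
  conflation u v -> projective I ->
  forall (Y : C) (f g : hom X Y),
    stable_eq f g <-> exists k : hom I Y, f - g = k \oc u.
Proof.
move=> uv pI Y f g; split=> [[P [pP [a [b ->]]]]|[k kE]].
  have [a' <-] := projective_injective CF pP uv a.
  by exists (b \oc a'); rewrite compA.
by exists I; split=> //; exists u, k.
Qed.

Lemma stable_refl (X Y : C) (f : hom X Y) : stable_eq f f.
Proof.
have [I [Z [u [v [uv pI]]]]] := enough_injectives CF X.
by apply/(stable_eqP uv pI); exists 0; rewrite comp0m subrr.
Qed.

Lemma stable_sym (X Y : C) (f g : hom X Y) : stable_eq f g -> stable_eq g f.
Proof.
have [I [Z [u [v [uv pI]]]]] := enough_injectives CF X.
move=> /(stable_eqP uv pI)[k kE]; apply/(stable_eqP uv pI); exists (- k).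
by rewrite compNm -kE opprB.
Qed.

Lemma stable_trans (X Y : C) (g f h : hom X Y) :
  stable_eq f g -> stable_eq g h -> stable_eq f h.
Proof.
have [I [Z [u [v [uv pI]]]]] := enough_injectives CF X.
move=> /(stable_eqP uv pI)[k kE] /(stable_eqP uv pI)[k' kE'].
apply/(stable_eqP uv pI); exists (k + k').
by rewrite compDl -kE -kE' addrA subrK.
Qed.

Lemma stable_compl (X Y Z : C) (g : hom Y Z) (f f' : hom X Y) :
  stable_eq f f' -> stable_eq (g \oc f) (g \oc f').
Proof.
move=> [P [pP [a [b E]]]]; exists P; split=> //; exists a, (g \oc b).
by rewrite -compBr E compA.
Qed.

Lemma stable_compr (X Y Z : C) (g g' : hom Y Z) (f : hom X Y) :
  stable_eq g g' -> stable_eq (g \oc f) (g' \oc f).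
Proof.
move=> [P [pP [a [b E]]]]; exists P; split=> //; exists (a \oc f), b.
by rewrite -compBl E compA.
Qed.

Lemma stable_sub0 (X Y : C) (f g : hom X Y) : stable_eq (f - g) 0 -> stable_eq f g.
Proof. by move=> [P [pP [a [b E]]]]; exists P; split=> //; exists a, b; rewrite -E subr0. Qed.

Lemma stable_iso_comp (X Y Z : C) (g : hom Y Z) (f : hom X Y) :
  stable_iso g -> stable_iso f -> stable_iso (g \oc f).
Proof.
move=> [g' [g1 g2]] [f' [f1 f2]]; exists (f' \oc g'); split.
  apply: stable_trans f1; rewrite -compA; apply: stable_compl.
  rewrite compA -{2}(comp1m f); exact: stable_compr.
apply: stable_trans g2; rewrite -compA; apply: stable_compl.
rewrite compA -{2}(comp1m g'); exact: stable_compr.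
Qed.

(** Turns projectivity into a stable statement, which can be transported along lifts. *)
Lemma projective_stable_zero (X : C) : stable_eq (idm X) 0 <-> projective X.
Proof.
split=> [[P [pP [a [b E]]]]|pX].
  by apply: (@retract_projective _ _ _ a b) => //; rewrite -E subr0.
by exists X; split=> //; exists (idm X), (idm X); rewrite subr0 comp1m.
Qed.

(** [x1 - x2] factors as [b \oc a] through a projective, and [a] extends to [a'] along [u] because
    projectives are injective. Then [h1 - h2 - u' \oc b \oc a'] vanishes on [u] and descends to
    [d : Z -> I'] with [z1 - z2 = v' \oc d]. *)
Lemma induced_stable_eq (X I Z X' I' Z' : C)
    (u : hom X I) (v : hom I Z) (u' : hom X' I') (v' : hom I' Z')
    (x1 x2 : hom X X') (h1 h2 : hom I I') (z1 z2 : hom Z Z') :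
  conflation u v -> conflation u' v' -> projective I' ->
  h1 \oc u = u' \oc x1 -> z1 \oc v = v' \oc h1 ->
  h2 \oc u = u' \oc x2 -> z2 \oc v = v' \oc h2 ->
  stable_eq x1 x2 -> stable_eq z1 z2.
Proof.
move=> uv uv' pI' hu1 zv1 hu2 zv2 [P [pP [a [b E]]]].
have [a' aE] := projective_injective CF pP uv a.
have [|d dE] := confl_coker CF (g := h1 - h2 - u' \oc b \oc a') uv.
  by rewrite !compBl hu1 hu2 -compBr E -!compA aE subrr.
exists I'; split=> //; exists d, v'.
apply/eqP; rewrite -subr_eq0; apply/eqP; apply: (confl_epi CF uv).
rewrite !compBl zv1 zv2 -!compA dE compBr compBr !compA (confl_comp CF uv').
by rewrite !comp0m subr0 subrr.
Qed.

(** Extending [u] along [u'] yields a candidate inverse. Both composites lie over [idm X], as the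
    identities do, so [induced_stable_eq] identifies them. *)
Lemma induced_stable_iso (X I Z I' Z' : C)
    (u : hom X I) (v : hom I Z) (u' : hom X I') (v' : hom I' Z')
    (h : hom I I') (z : hom Z Z') :
  conflation u v -> conflation u' v' -> projective I -> projective I' ->
  h \oc u = u' -> z \oc v = v' \oc h -> stable_iso z.
Proof.
move=> uv uv' pI pI' hu zv.
have [k ku] := projective_injective CF pI uv' u.
have [|y yv] := confl_coker CF (g := v \oc k) uv'.
  by rewrite -compA ku (confl_comp CF uv).
exists y; split.
  apply: (@induced_stable_eq _ _ _ _ _ _ u v u v (idm X) (idm X) (k \oc h) (idm I)) => //.
  - by rewrite -compA hu ku compm1.
  - by rewrite -compA zv !compA yv.
  - by rewrite comp1m compm1.
  - by rewrite comp1m compm1.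
  - exact: stable_refl.
apply: (@induced_stable_eq _ _ _ _ _ _ u' v' u' v' (idm X) (idm X) (h \oc k) (idm I')) => //.
- by rewrite -compA ku hu compm1.
- by rewrite -compA yv !compA zv.
- by rewrite comp1m compm1.
- by rewrite comp1m compm1.
- exact: stable_refl.
Qed.

End StableFrobenius.

(** * Triangle functors from presentations *)

(* An object [pobj p] of [D], with [p : pres M], is to be thought of as a
   presentation of [M], and [covers f h] as saying that [h] is the morphism
   which [f] induces between the presented objects. *)
Record presentations (C D : confCat) := Presentations {
  pres : C -> Type;
  pobj : forall M, pres M -> D;
  covers : forall (M N : C) (p : pres M) (q : pres N),
    hom (pobj p) (pobj q) -> hom M N -> Prop;
  covers_id : forall (M : C) (p : pres M), covers (idm (pobj p)) (idm M);
  covers_comp : forall (L M N : C) (p : pres L) (q : pres M) (r : pres N)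
      (g : hom (pobj q) (pobj r)) (f : hom (pobj p) (pobj q)) k h,
    covers g k -> covers f h -> covers (g \oc f) (k \oc h);
  covers_add : forall (M N : C) (p : pres M) (q : pres N)
      (f f' : hom (pobj p) (pobj q)) h h',
    covers f h -> covers f' h' -> covers (f + f') (h + h');
  covers_opp : forall (M N : C) (p : pres M) (q : pres N)
      (f : hom (pobj p) (pobj q)) h, covers f h -> covers (- f) (- h);
  covers_uniq : forall (M N : C) (p : pres M) (q : pres N)
      (f : hom (pobj p) (pobj q)) h h', covers f h -> covers f h' -> h = h';
  covers_induced : forall (M N : C) (p : pres M) (q : pres N)
      (f : hom (pobj p) (pobj q)), exists h, covers f h;
  covers_lift : forall (M N : C) (p : pres M) (q : pres N) (h : hom M N),
    exists f : hom (pobj p) (pobj q), covers f h;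
  covers_zero : forall (M N : C) (p : pres M) (q : pres N)
      (f : hom (pobj p) (pobj q)), covers f 0 -> stable_eq f 0;
  pres_exists : forall M, inhabited (pres M);
  pres_conflation : forall (M N L : C) (u : hom M N) (v : hom N L),
    conflation u v -> forall (p : pres M) (r : pres L),
    exists (q : pres N) (u' : hom (pobj p) (pobj q)) (v' : hom (pobj q) (pobj r)),
      [/\ conflation u' v', covers u' u & covers v' v];
  pres_cover : forall M, exists (K P : C) (u : hom K P) (v : hom P M),
    conflation u v /\ exists q : pres P, projective (pobj q);
  pres_projective : forall X : D, projective X ->
    exists (P : C) (q : pres P) (s : hom X (pobj q)) (r : hom (pobj q) X),
      projective P /\ r \oc s = idm X
}.

Section PresentedFunctor.
Variables (C D : confCat) (CF : frobenius_like C) (DF : frobenius_like D).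
Variable A : presentations C D.
Notation pres := (pres A).
Notation pobj := (@pobj _ _ A _).
Notation covers := (@covers _ _ A _ _ _ _).

Lemma covers_sub (M N : C) (p : pres M) (q : pres N)
    (f f' : hom (pobj p) (pobj q)) h h' :
  covers f h -> covers f' h' -> covers (f - f') (h - h').
Proof. by move=> c c'; apply: covers_add => //; apply: covers_opp. Qed.

Lemma covers_same (M N : C) (p : pres M) (q : pres N)
    (f f' : hom (pobj p) (pobj q)) h :
  covers f h -> covers f' h -> stable_eq f f'.
Proof.
move=> c c'; apply/stable_sub0/covers_zero.
by rewrite -(subrr h); apply: covers_sub.
Qed.

(** The projective [P] through which [h - h'] factors is not known at this point to have a
    projective presentation. It is a retract of the middle term [Q] of a cover, which has one, so
    the factorization is lifted through [Q]. *)
Lemma covers_stable (M N : C) (p : pres M) (q : pres N)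
    (f f' : hom (pobj p) (pobj q)) h h' :
  covers f h -> covers f' h' ->
  stable_eq h h' -> stable_eq f f'.
Proof.
move=> c c' [P [pP [a [b E]]]]; apply: stable_sub0.
have [K [Q [u [v [uv [q0 pq0]]]]]] := pres_cover A P.
have [s vs] := pP _ _ _ _ _ uv (idm P).
have [f1 c1] := covers_lift p q0 (s \oc a).
have [f2 c2] := covers_lift q0 q (b \oc v).
have e : h - h' = (b \oc v) \oc (s \oc a).
  by rewrite E compA -(compA b) vs compm1.
have st : stable_eq (f - f') (f2 \oc f1).
  apply: (@covers_same _ _ _ _ _ _ (h - h')); first exact: covers_sub.
  by rewrite e; exact: covers_comp.
apply: (stable_trans DF st).
by exists (pobj q0); split=> //; exists f1, f2; rewrite subr0.
Qed.

(** A projective of [D] is a retract of a presentation of a projective of [C], so the factorization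
    survives on the presented objects. *)
Lemma covers_stable_inv (M N : C) (p : pres M) (q : pres N)
    (f f' : hom (pobj p) (pobj q)) h h' :
  covers f h -> covers f' h' ->
  stable_eq f f' -> stable_eq h h'.
Proof.
move=> c c' [X [pX [a [b E]]]].
have [P [q0 [s [r [pP rs]]]]] := pres_projective A pX.
have [k1 c1] := covers_induced (s \oc a).
have [k2 c2] := covers_induced (b \oc r).
exists P; split=> //; exists k1, k2.
apply: (@covers_uniq _ _ A _ _ _ _ (f - f')); first exact: covers_sub.
have -> : f - f' = (b \oc r) \oc (s \oc a).
  by rewrite E compA -(compA b) rs compm1.
exact: covers_comp.
Qed.

(** [idm] and [0] cover stably equal endomorphisms of [M], hence are stably equal themselves. *)
Lemma pobj_projective (M : C) (p : pres M) : projective M -> projective (pobj p).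
Proof.
move=> pM; apply/projective_stable_zero.
apply: (covers_stable (covers_id p)); last exact/projective_stable_zero.
by rewrite -[X in covers X _](subrr (idm _))
  -[X in covers _ X](subrr (idm _)); apply: covers_sub; apply: covers_id.
Qed.

Definition tobj (M : C) : pres M :=
  sval (cid (let: inhabits p := pres_exists A M in ex_intro (fun _ => True) p I)).

Definition tmap (M N : C) (h : hom M N) : hom (pobj (tobj M)) (pobj (tobj N)) :=
  sval (cid (covers_lift (tobj M) (tobj N) h)).

Lemma tmapP (M N : C) (h : hom M N) : covers (tmap h) h.
Proof. by rewrite /tmap; case: cid. Qed.

Lemma tmap_eq (M N : C) (h h' : hom M N) :
  stable_eq h h' -> stable_eq (tmap h) (tmap h').
Proof. exact: covers_stable (tmapP _) (tmapP _). Qed.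

Lemma tmap_id (M : C) : stable_eq (tmap (idm M)) (idm _).
Proof. exact: covers_same (tmapP _) (covers_id _). Qed.

Lemma tmap_comp (L M N : C) (k : hom M N) (h : hom L M) :
  stable_eq (tmap (k \oc h)) (tmap k \oc tmap h).
Proof. by apply: covers_same (tmapP _) _; apply: covers_comp; apply: tmapP. Qed.

Lemma tmap_add (M N : C) (k h : hom M N) :
  stable_eq (tmap (k + h)) (tmap k + tmap h).
Proof. by apply: covers_same (tmapP _) _; apply: covers_add; apply: tmapP. Qed.

Lemma tmap_iso (M N : C) (h : hom M N) : stable_iso h -> stable_iso (tmap h).
Proof.
move=> [k [kh hk]]; exists (tmap k); split.
- apply: stable_trans (tmap_id _) => //; apply: stable_trans (tmap_eq kh) => //.
  exact/stable_sym/tmap_comp.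
- apply: stable_trans (tmap_id _) => //; apply: stable_trans (tmap_eq hk) => //.
  exact/stable_sym/tmap_comp.
Qed.

Variables (sC : happel_shift C) (sD : happel_shift D).

(* The shift comparison comes from a conflation presenting the hull of [M]: its
   middle term is projective, so it can be compared with the hull in [D]. *)
Lemma tshift_exists (M : C) :
  exists (c : hom (pobj (tobj (shift sC M))) (shift sD (pobj (tobj M))))
    (q : pres (hull sC M))
    (u : hom (pobj (tobj M)) (pobj q)) (v : hom (pobj q) (pobj (tobj (shift sC M))))
    (k : hom (pobj q) (hull sD (pobj (tobj M)))),
  [/\ [/\ conflation u v, covers u (hull_in sC M) & covers v (hull_out sC M)],
    k \oc u = hull_in sD _ & c \oc v = hull_out sD _ \oc k].
Proof.
have [q [u [v [uv cu cv]]]] :=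
  pres_conflation (hull_conflation sC M) (tobj M) (tobj (shift sC M)).
have [k ku] := hull_injective (h := sD) uv (hull_in sD (pobj (tobj M))).
have [|c cE] := confl_coker DF (g := hull_out sD _ \oc k) uv.
  by rewrite -compA ku (confl_comp DF (hull_conflation sD _)).
by exists c, q, u, v, k.
Qed.

Definition tshift (M : C) : hom (pobj (tobj (shift sC M))) (shift sD (pobj (tobj M))) :=
  sval (cid (tshift_exists M)).

Lemma tshift_iso (M : C) : stable_iso (tshift M).
Proof.
have [q [u [v [k [[uv _ _] ku cv]]]]] := svalP (cid (tshift_exists M)).
apply: (induced_stable_iso DF uv (hull_conflation sD _)) ku cv.
- exact/pobj_projective/hull_projective.
- exact: hull_projective.
Qed.

(** Both composites are induced over [tmap f], once [tmap (shift_map sC f)] is replaced by the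
    morphism [z] that [tmap f] induces between the presented conflations. *)
Lemma tshift_natural (M N : C) (f : hom M N) :
  stable_eq (tshift N \oc tmap (shift_map sC f))
            (shift_map sD (tmap f) \oc tshift M).
Proof.
have [q [u [v [k [[uv cu cv] ku sv]]]]] := svalP (cid (tshift_exists M)).
have [q' [u' [v' [k' [[uv' cu' cv'] ku' sv']]]]] := svalP (cid (tshift_exists N)).
have pq' : projective (pobj q') by exact/pobj_projective/hull_projective.
have [h hu] := projective_injective DF pq' uv (u' \oc tmap f).
have [|z zv] := confl_coker DF (g := v' \oc h) uv.
  by rewrite -compA hu compA (confl_comp DF uv') comp0m.
(* What [z] induces in [C] lies over [f] between the hull conflations, as does [shift_map sC f]; so
   these agree stably, and so do their lifts. *)
have st : stable_eq z (tmap (shift_map sC f)).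
  have [zc czc] := covers_induced z; have [hc chc] := covers_induced h.
  have [g [gi go]] := shift_mapP sC f.
  apply: (covers_stable czc (tmapP _)).
  apply: (@induced_stable_eq _ CF _ _ _ _ _ _ (hull_in sC M) (hull_out sC M)
    (hull_in sC N) (hull_out sC N) f f hc g) => //.
  - exact: hull_conflation.
  - exact: hull_conflation.
  - exact: hull_projective.
  - apply: (@covers_uniq _ _ A _ _ _ _ (h \oc u)); first exact: covers_comp.
    by rewrite hu; apply: covers_comp => //; exact: tmapP.
  - apply: (@covers_uniq _ _ A _ _ _ _ (z \oc v)); first exact: covers_comp.
    by rewrite zv; apply: covers_comp.
  - exact: stable_refl.
apply: (stable_trans DF (stable_compl _ (stable_sym DF st))).
have [g [gi go]] := shift_mapP sD (tmap f).
apply: (@induced_stable_eq _ DF _ _ _ _ _ _ u v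
    (hull_in sD _) (hull_out sD _) (tmap f) (tmap f) (k' \oc h) (g \oc k)) => //.
- exact: hull_conflation.
- exact: hull_projective.
- by rewrite -compA hu compA ku'.
- by rewrite -compA zv !compA sv'.
- by rewrite -compA ku gi.
- by rewrite -compA sv !compA go.
- exact: stable_refl.
Qed.

(** The chosen presentation of [N] need not be the middle term [q] of the lifted conflation; the
    lifts [e], [e'] of [idm N] identify the two stably and give the isomorphism of triangles. *)
Lemma tmap_conflation_triangle (M N L : C) (u : hom M N) (v : hom N L)
    (w : hom L (shift sC M)) :
  conflation_triangle u v w ->
  distinguished (tmap u) (tmap v) (tshift M \oc tmap w).
Proof.
move=> [uv [h [hu wv]]].
have [q [u' [v' [uv' cu cv]]]] := pres_conflation uv (tobj M) (tobj L).
have [qI [i [p [k [[ip ci cp] ki sp]]]]] := svalP (cid (tshift_exists M)).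
have pqI : projective (pobj qI) by exact/pobj_projective/hull_projective.
have [h' hu'] := projective_injective DF pqI uv' i.
(* With the sign of [conflation_triangle], the morphism induced by [w'] and [w] itself both lie over
   [- idm M]. *)
have [|w' wv'] := confl_coker DF (g := - (p \oc h')) uv'.
  by rewrite compNm -compA hu' (confl_comp DF ip) oppr0.
have st : stable_eq w' (tmap w).
  have [wc cwc] := covers_induced w'; have [hc chc] := covers_induced h'.
  apply: (covers_stable cwc (tmapP _)).
  apply: (@induced_stable_eq _ CF _ _ _ _ _ _ u v
    (hull_in sC M) (hull_out sC M) (- idm M) (- idm M) (- hc) (- h)) => //.
  - exact: hull_conflation.
  - exact: hull_projective.
  - rewrite compNm compmN compm1; congr (- _).
    apply: (@covers_uniq _ _ A _ _ _ _ (h' \oc u')); first exact: covers_comp.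
    by rewrite hu'.
  - rewrite compmN; apply: (@covers_uniq _ _ A _ _ _ _ (w' \oc v')).
      exact: covers_comp.
    by rewrite wv'; apply/covers_opp/covers_comp.
  - by rewrite compNm compmN compm1 hu.
  - by rewrite compmN.
  - exact: stable_refl.
have [e ce] := covers_lift (tobj N) q (idm N).
have [e' ce'] := covers_lift q (tobj N) (idm N).
exists (pobj (tobj M)), (pobj q), (pobj (tobj L)), u', v', (tshift M \oc w').
split.
  split=> //; exists (k \oc h'); split; first by rewrite -compA hu'.
  by rewrite -compA wv' compmN !compA sp.
exists (idm _), e, (idm _).
have isoid (X : D) : stable_iso (idm X).
  by exists (idm X); rewrite comp1m; split; exact: stable_refl.
split; split=> //.
- exists e'; split.
    apply: (@covers_same _ _ _ _ _ _ (idm N)); last exact: covers_id.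
    by rewrite -[X in covers _ X](comp1m (idm N)); exact: covers_comp.
  apply: (@covers_same _ _ _ _ _ _ (idm N)); last exact: covers_id.
  by rewrite -[X in covers _ X](comp1m (idm N)); exact: covers_comp.
- rewrite compm1; apply: (@covers_same _ _ _ _ _ _ u) => //.
  by rewrite -[X in covers _ X](comp1m u); apply: covers_comp => //; exact: tmapP.
- rewrite comp1m; apply: (@covers_same _ _ _ _ _ _ v); first exact: tmapP.
  by rewrite -[X in covers _ X](compm1 v); apply: covers_comp.
- rewrite compm1; have [g [gi go]] := shift_mapP sD (idm (pobj (tobj M))).
  have st1 : stable_eq (shift_map sD (idm (pobj (tobj M)))) (idm _).
    apply: (@induced_stable_eq _ DF _ _ _ _ _ _ (hull_in sD _) (hull_out sD _)
      (hull_in sD _) (hull_out sD _) (idm _) (idm _) g (idm _)) => //.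
    + exact: hull_conflation.
    + exact: hull_conflation.
    + exact: hull_projective.
    + by rewrite comp1m compm1.
    + by rewrite comp1m compm1.
    + exact: stable_refl.
  apply: (stable_trans DF (stable_compr _ st1)); rewrite comp1m.
  exact/stable_compl/stable_sym.
Qed.

Lemma tmap_distinguished (M N L : C) (u : hom M N) (v : hom N L)
    (w : hom L (shift sC M)) :
  distinguished u v w -> distinguished (tmap u) (tmap v) (tshift M \oc tmap w).
Proof.
move=> [M' [N' [L' [u' [v' [w' [tri [a [b [c [[ia ib ic] [eu ev ew]]]]]]]]]]]].
have [M2 [N2 [L2 [u2 [v2 [w2 [tri2 [a2 [b2 [c2 [[ia2 ib2 ic2] [eu2 ev2 ew2]]]]]]]]]]]]
  := tmap_conflation_triangle tri.
exists M2, N2, L2, u2, v2, w2; split=> //.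
exists (a2 \oc tmap a), (b2 \oc tmap b), (c2 \oc tmap c).
have sq X1 X2 X3 X4 (f : hom X1 X2) (g : hom X2 X4) (f' : hom X1 X3) (g' : hom X3 X4) :
    stable_eq (g \oc f) (g' \oc f') ->
    stable_eq (tmap g \oc tmap f) (tmap g' \oc tmap f').
  move=> e; apply: (stable_trans DF (stable_sym DF (tmap_comp _ _))).
  exact: (stable_trans DF (tmap_eq e) (tmap_comp _ _)).
split; first by split; apply: stable_iso_comp => //; exact: tmap_iso.
split.
- rewrite -compA; apply: (stable_trans DF (stable_compl _ (sq _ _ _ _ _ _ _ _ eu))).
  by rewrite !compA; exact: stable_compr.
- rewrite -compA; apply: (stable_trans DF (stable_compl _ (sq _ _ _ _ _ _ _ _ ev))).
  by rewrite !compA; exact: stable_compr.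
have [g [gi go]] := shift_mapP sD (a2 \oc tmap a).
have [g1 [gi1 go1]] := shift_mapP sD (tmap a).
have [g2 [gi2 go2]] := shift_mapP sD a2.
(* [shift_map] is a separate choice for each morphism, hence multiplicative only stably. *)
have st1 : stable_eq (shift_map sD (a2 \oc tmap a))
    (shift_map sD a2 \oc shift_map sD (tmap a)).
  apply: (@induced_stable_eq _ DF _ _ _ _ _ _ (hull_in sD _) (hull_out sD _)
    (hull_in sD _) (hull_out sD _) (a2 \oc tmap a) (a2 \oc tmap a) g (g2 \oc g1)) => //.
  + exact: hull_conflation.
  + exact: hull_conflation.
  + exact: hull_projective.
  + by rewrite -compA gi1 !compA gi2.
  + by rewrite -compA go1 !compA go2.
  + exact: stable_refl.
apply: (stable_trans DF (stable_compr _ st1)); rewrite compA -(compA _ _ (tshift M)).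
apply: (stable_trans DF (stable_compr _ (stable_compl _ (stable_sym DF (tshift_natural a))))).
rewrite -!compA.
apply: (stable_trans DF (stable_compl _ (stable_compl _ (sq _ _ _ _ _ _ _ _ ew)))).
by rewrite !compA; apply: stable_compr; rewrite -compA.
Qed.

Definition presented_functor : triangle_functor sC sD :=
  @TriangleFunctor C D sC sD (fun M => pobj (tobj M)) tmap tmap_eq tmap_id
    tmap_comp tmap_add tshift tshift_iso tshift_natural tmap_distinguished.

Lemma presented_functor_fully_faithful : fully_faithful presented_functor.
Proof.
move=> M N; split=> [f g|h /=]; first exact: covers_stable_inv (tmapP f) (tmapP g).
have [k ck] := covers_induced h.
by exists k; apply: covers_same (tmapP k) ck.
Qed.

End PresentedFunctor.

(** * Modules over a commutative ring *)

Section Submodules.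
Variables (A : comNzRingType) (M : lmodType A) (P : M -> Prop).
Hypotheses (P0 : P 0) (PD : forall a x y, P x -> P y -> P (a *: x + y)).

Definition submodule_pred : {pred M} := fun x => `[< P x >].

Lemma submodule_pred_closed : submod_closed submodule_pred.
Proof.
split=> [|a x y /asboolP Px /asboolP Py]; apply/asboolP => //; exact: PD.
Qed.

HB.instance Definition _ :=
  GRing.isSubmodClosed.Build A M submodule_pred submodule_pred_closed.

Record submodule := Submodule {
  submodule_val : M;
  submodule_valP : submodule_pred submodule_val
}.
HB.instance Definition _ := [isSub for submodule_val].
HB.instance Definition _ := [Choice of submodule by <:].
HB.instance Definition _ := [SubChoice_isSubLmodule of submodule by <:].

Lemma submodule_exists : exists (K : lmodType A) (j : {linear K -> M}),
  injective j /\ forall x, P x <-> exists k, j k = x.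
Proof.
exists submodule, (\val : {linear submodule -> M}); split; first exact: val_inj.
move=> x; split=> [Px|[k <-]]; last exact/asboolP/(valP k).
have Px' : submodule_pred x by exact/asboolP.
by exists (Sub x Px').
Qed.

End Submodules.

Section LinearMaps.
Variable A : comNzRingType.

Lemma linear_of_fun (M N : lmodType A) (f : M -> N) :
  (forall a x y, f (a *: x + y) = a *: f x + f y) ->
  exists g : {linear M -> N}, forall x, g x = f x.
Proof.
move=> fl; have fl' : linear f by [].
pose g : {linear M -> N} := HB.pack f (GRing.isLinear.Build A M N _ f fl').
by exists g.
Qed.

Lemma factor_surj (M N Q : lmodType A) (v : {linear M -> N}) (g : {linear M -> Q}) :
  (forall y, exists x, v x = y) -> (forall x, v x = 0 -> g x = 0) ->
  exists h : {linear N -> Q}, forall x, h (v x) = g x.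
Proof.
move=> /choice[s vs] vg.
have E x : g (s (v x)) = g x.
  by apply/eqP; rewrite -subr_eq0 -linearB vg ?linearB ?vs ?subrr.
have [a x y|h hE] := @linear_of_fun N Q (g \o s).
  by rewrite /= -linearP -[RHS]E linearP !vs.
by exists h => x; rewrite hE /= E.
Qed.

Lemma factor_inj (K N L : lmodType A) (j : {linear K -> N}) (g : {linear L -> N}) :
  injective j -> (forall x, exists k, j k = g x) ->
  exists h : {linear L -> K}, forall x, j (h x) = g x.
Proof.
move=> ji /choice[s js].
have [a x y|h hE] := @linear_of_fun L K s.
  by apply: ji; rewrite linearP !js linearP.
by exists h => x; rewrite hE.
Qed.

Lemma kernel_exists (M N : lmodType A) (f : {linear M -> N}) :
  exists (K : lmodType A) (j : {linear K -> M}),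
    injective j /\ forall x, f x = 0 <-> exists k, j k = x.
Proof.
apply: submodule_exists; first exact: linear0.
by move=> a x y fx fy; rewrite linearP fx fy scaler0 add0r.
Qed.

End LinearMaps.

(** * Free modules and finite generation *)

Section FreeModules.
Variable A : comNzRingType.

Lemma linear_of_basis (n : nat) (M : lmodType A) (e : 'I_n -> M) :
  exists f : {linear 'rV[A]_n -> M}, forall x, f x = \sum_i x 0 i *: e i.
Proof.
apply: linear_of_fun => a x y; rewrite scaler_sumr -big_split /=.
by apply: eq_bigr => i _; rewrite !mxE scalerDl scalerA.
Qed.

Lemma linear_row_sum (n : nat) (M : lmodType A) (f : {linear 'rV[A]_n -> M}) x :
  f x = \sum_i x 0 i *: f (delta_mx 0 i).
Proof.
by rewrite {1}(row_sum_delta x) linear_sum; apply: eq_bigr => i _; rewrite linearZ.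
Qed.

Lemma free_lift (n : nat) (M N : lmodType A) (g : {linear M -> N})
    (h : {linear 'rV[A]_n -> N}) :
  (forall x, exists y, g y = h x) ->
  exists k : {linear 'rV[A]_n -> M}, forall x, g (k x) = h x.
Proof.
move=> gs; have /choice[e eE] i := gs (delta_mx 0 i).
have [k kE] := linear_of_basis e; exists k => x.
rewrite kE linear_sum (linear_row_sum h); apply: eq_bigr => i _.
by rewrite linearZ eE.
Qed.

Lemma free_projective (n : nat) : projective_module ('rV[A]_n : lmodType A).
Proof. by move=> M N g h gs; apply: free_lift. Qed.

Lemma fgP (M : lmodType A) : finitely_generated M <->
  exists (n : nat) (p : {linear 'rV[A]_n -> M}), forall y, exists x, p x = y.
Proof.
split=> [[n [e eE]]|[n [p ps]]].
  have [p pE] := linear_of_basis e; exists n, p => y.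
  have [c ->] := eE y; exists (\row_i c i); rewrite pE.
  by apply: eq_bigr => i _; rewrite mxE.
exists n, (fun i => p (delta_mx 0 i)) => y; have [x <-] := ps y.
by exists (x 0); rewrite {1}linear_row_sum.
Qed.

Lemma fg_free (n : nat) : finitely_generated ('rV[A]_n : lmodType A).
Proof. by apply/fgP; exists n, (idfun : {linear _ -> _}) => y; exists y. Qed.

(** Induction on [n]. The first coordinates of [K] form an ideal, whose generators lift to [K]; the
    elements with first coordinate zero embed in a free module of rank one less. *)
Lemma noetherian_submodule : noetherian A ->
  forall (n : nat) (K : lmodType A) (j : {linear K -> 'rV[A]_n}),
    injective j -> finitely_generated K.
Proof.
move=> An; elim=> [|n IHn] K j ji.
  exists 0%N, (fun _ => 0) => x; exists (fun _ => 0); rewrite big_ord0.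
  by apply: ji; rewrite linear0; apply/rowP; case.
pose c x : A := j x 0 0.
have cl a x y : c (a *: x + y) = a * c x + c y by rewrite /c linearP !mxE.
have [|m [e eE]] := An [set a | exists k, c k = a]%classic.
  split=> [|_ _ [x <-] [y <-]|a _ [x <-]].
  - by exists 0; rewrite /c linear0 mxE.
  - by exists (1 *: x + y); rewrite cl mul1r.
  - by exists (a *: x + 0); rewrite cl /c linear0 mxE addr0.
have /choice[k ke] i : exists k, c k = e i.
  by apply/eE; exists (fun i' => (i' == i)%:R); rewrite (bigD1 i) //= eqxx mul1r
    big1 ?addr0 // => i' /negbTE->; rewrite mul0r.
have [p1 p1E] := linear_of_basis k.
have cp1 x : c (p1 x) = \sum_i x 0 i * e i.
  rewrite p1E /c linear_sum summxE; apply: eq_bigr => i _.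
  by rewrite linearZ mxE -ke.
have [|a x y|L [i [ii iE]]] := @submodule_exists A K (fun x => c x = 0).
- by rewrite /c linear0 mxE.
- by move=> cx cy; rewrite cl cx cy mulr0 addr0.
have [jj jjE] := @linear_of_fun A 'rV[A]_n.+1 'rV[A]_n (fun x => \row_l x 0 (lift ord0 l))
  ltac:(by move=> a x y; apply/rowP=> l; rewrite !mxE).
have /fgP[l [p2 p2s]] : finitely_generated L.
  apply: (IHn _ (jj \o j \o i : {linear _ -> _})) => x y /= E.
  apply/ii/ji/rowP => t; case: (unliftP ord0 t) => [t' ->|->].
    by move/rowP/(_ t'): E; rewrite !jjE !mxE.
  have /iE cx : exists k, i k = i x by exists x.
  have /iE cy : exists k, i k = i y by exists y.
  by rewrite -/(c (i x)) -/(c (i y)) cx cy.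
apply/fgP; exists (m + l)%N.
have [p pE] := @linear_of_fun A 'rV[A]_(m + l) K
  (fun x => p1 (lsubmx x) + i (p2 (rsubmx x)))
  ltac:(by move=> a x y; rewrite /= !linearP /= scalerDr addrACA).
exists p => y.
have [d dE] : exists d : 'I_m -> A, c y = \sum_i d i * e i by apply/eE; exists y.
have [z zE] : exists z, i z = y - p1 (\row_i d i).
  apply/iE; rewrite -scaleN1r addrC cl cp1 dE mulN1r.
  apply/eqP; rewrite addrC subr_eq0; apply/eqP.
  by apply: eq_bigr => t _; rewrite mxE.
have [x2 x2E] := p2s z.
by exists (row_mx (\row_i d i) x2); rewrite pE row_mxKl row_mxKr x2E zE addrC subrK.
Qed.

Lemma fg_sub_free_cover : noetherian A ->
  forall M : lmodType A, finitely_generated M ->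
  exists (n : nat) (K : lmodType A) (j : {linear K -> 'rV[A]_n})
    (p : {linear 'rV[A]_n -> M}), short_exact j p /\ finitely_generated K.
Proof.
move=> An M /fgP[n [p ps]]; have [K [j [ji jE]]] := kernel_exists p.
by exists n, K, j, p; split=> //; apply: (noetherian_submodule An ji).
Qed.

End FreeModules.

(** * Vanishing of Ext *)

Section Ext.
Variable A : comNzRingType.

Definition extends_along (K F N : lmodType A) (j : {linear K -> F}) : Prop :=
  forall phi : {linear K -> N}, exists psi : {linear F -> N},
    forall k, psi (j k) = phi k.

Definition Ext_positive_vanishes (M N : lmodType A) : Prop :=
  forall i, (0 < i)%N -> Ext_vanishes i M N.

Lemma short_exact_comp0 (X Y Z : lmodType A) (f : {linear X -> Y})
    (g : {linear Y -> Z}) : short_exact f g -> forall x, g (f x) = 0.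
Proof. by move=> [_ e _] x; apply/e; exists x. Qed.

(* The vanishing of Ext is tested on all resolutions; [M'] is allowed to differ
   from [M] by projective summands so that the induction can pass to syzygies. *)
Lemma Ext_vanishes_retract (N : lmodType A) (X : lmodType A -> Prop) :
  (forall M, X M -> exists (K P : lmodType A) (j : {linear K -> P})
     (p : {linear P -> M}),
     [/\ projective_module P, short_exact j p, X K & extends_along N j]) ->
  forall i (M M' F : lmodType A) (a : {linear M -> M'}) (b : {linear M' -> M})
    (s : {linear F -> M'}) (t : {linear M' -> F}),
  X M -> projective_module F -> (forall y, a (b y) = y + s (t y)) ->
  Ext_vanishes i.+1 M' N.
Proof.
move=> XP; elim=> [|i IHi] M M' F a b s t XM pF abE Q phi phid /=.
all: have [K [P [j [p [pP jp XK jN]]]]] := XP M XM.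
all: have [L [l [li lE]]] := kernel_exists (res_aug Q).
all: have [ji jE ps] := jp.
all: have [d0 d0E] : exists d0 : {linear Q 1 -> L}, forall x, l (d0 x) = res_d Q 0 x
  by apply: factor_inj => // x; apply/lE/res_exact0; exists x.
all: have d0s y : exists x, d0 x = y
  by have [|x xE] := (res_exact0 (l y)).1;
    [by apply/lE; exists y | exists x; apply: li; rewrite d0E].
all: have [a0 a0E] := pP _ _ (res_aug Q) (a \o p : {linear _ -> _}) (@res_aug_surj _ _ Q).
all: have [b0 b0E] := @res_projective _ _ Q 0 _ _ _ (b \o res_aug Q : {linear _ -> _}) ps.
all: have [s0 s0E] := pF _ _ (res_aug Q) s (@res_aug_surj _ _ Q).
all: have auglE x : res_aug Q (l x) = 0 by apply/lE; exists x.
all: have [a1 a1E] : exists a1 : {linear K -> L}, forall x, l (a1 x) = a0 (j x)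
  by apply: (factor_inj (g := a0 \o j : {linear _ -> _})) => // x; apply/lE;
    rewrite /= a0E /= (short_exact_comp0 jp) linear0.
all: have [b1 b1E] : exists b1 : {linear L -> K}, forall x, j (b1 x) = b0 (l x)
  by apply: (factor_inj (g := b0 \o l : {linear _ -> _})) => // x; apply/jE;
    rewrite /= b0E /= auglE linear0.
(* The maps [a1], [b1] between the syzygies compose to the identity up to [dl \o l], which passes
   through the projective [Q 0]. So the hypothesis on [a], [b], [s], [t] recurs with [dl], [l] in
   place of [s], [t]. *)
all: have [dl dlE] : exists dl : {linear Q 0 -> L},
    forall x, l (dl x) = a0 (b0 x) - x - s0 (t (res_aug Q x))
  by apply: (factor_inj (g := a0 \o b0 \- idfun \- (s0 \o t \o res_aug Q) :
       {linear _ -> _})) => // x; apply/lE;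
    rewrite /= !linearB /= a0E /= b0E /= abE s0E addrAC addrK subrr.
all: have abl y : a1 (b1 y) = y + dl (l y)
  by apply: li; rewrite linearD a1E b1E dlE auglE (linear0 t) (linear0 s0) subr0 addrC subrK.
(* In degree one the cocycle descends to [f] on [L]; [f \o a1] extends from [K] to [P], and the
   error term [dl] is already defined on [Q 0]. *)
- have [f fE] : exists f : {linear L -> N}, forall x, f (d0 x) = phi x.
    apply: factor_surj => // x /(congr1 l); rewrite d0E linear0.
    by move=> /res_exact[y <-].
  have [psi psiE] := jN (f \o a1 : {linear _ -> _}).
  exists ((psi \o b0) \- (f \o dl) : {linear _ -> _}) => x /=.
  rewrite -d0E -b1E psiE /= abl linearD addrK fE; congr (_ x).
have ex0 : exact_at 0 (res_d Q 1) d0.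
  move=> y; split=> [/(congr1 l)|[x <-]]; first by rewrite d0E linear0 => /res_exact.
  by apply: li; rewrite d0E linear0; apply/res_exact; exists x.
(* Dropping [Q 0] leaves a resolution of [L], in which [phi] has one degree less. *)
pose T := @ProjResolution A L (fun n => Q n.+1) (fun n => res_d Q n.+1) d0
  (fun n => @res_projective _ _ Q n.+1) (fun n => @res_exact _ _ Q n.+1) ex0 d0s.
exact: (IHi K L (Q 0) a1 b1 dl l XK (@res_projective _ _ Q 0) abl T phi phid).
Qed.

Lemma Ext_vanishes_class (N : lmodType A) (X : lmodType A -> Prop) :
  (forall M, X M -> exists (K P : lmodType A) (j : {linear K -> P})
     (p : {linear P -> M}),
     [/\ projective_module P, short_exact j p, X K & extends_along N j]) ->
  forall M, X M -> Ext_positive_vanishes M N.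
Proof.
move=> XP M XM [//|i] _.
have [a aE] := @linear_of_fun A M M idfun (fun _ _ _ => erefl).
(* Here [M'] is [M], so the projective summand is taken to be the zero module. *)
have [t tE] := @linear_of_fun A M 'rV[A]_0 (fun _ => 0)
  (fun a x y => esym (etrans (addr0 _) (scaler0 _ a))).
have [s sE] := @linear_of_fun A 'rV[A]_0 M (fun _ => 0)
  (fun a x y => esym (etrans (addr0 _) (scaler0 _ a))).
apply: (Ext_vanishes_retract XP (a := a) (b := a) (s := s) (t := t)) => //.
  exact: free_projective.
by move=> y; rewrite !aE sE addr0.
Qed.

(** * Dimension shifting along syzygies *)

Section Splice.
Variables (K F M : lmodType A) (j : {linear K -> F}) (p : {linear F -> M}).
Hypotheses (pF : projective_module F) (jp : short_exact j p).
Variable Q : proj_resolution K.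

Definition splice_obj (i : nat) : lmodType A :=
  match i with 0 => F | k.+1 => Q k end.

Definition splice_d (i : nat) : {linear splice_obj i.+1 -> splice_obj i} :=
  match i with
  | 0 => (j \o res_aug Q : {linear Q 0 -> F})
  | k.+1 => res_d Q k
  end.

Lemma splice_projective i : projective_module (splice_obj i).
Proof. by case: i => [|i] //=; apply: res_projective. Qed.

Lemma splice_exact i : exact_at 0 (splice_d i.+1) (splice_d i).
Proof.
case: i => [|i] /=; last exact: res_exact.
have [ji jE _] := jp => y /=; split=> [|[x <-]].
  by rewrite -(linear0 j) => /ji/res_exact0.
by rewrite [res_aug Q _](iffRL (res_exact0 _)) ?linear0 //; exists x.
Qed.

Lemma splice_exact0 : exact_at 0 (splice_d 0) p.
Proof.
have [ji jE _] := jp => y /=; split=> [/jE[k <-]|[x <-]].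
  by have [x <-] := @res_aug_surj _ _ Q k; exists x.
by apply/jE; exists (res_aug Q x).
Qed.

Lemma splice_surj y : exists x, p x = y. Proof. by case: jp. Qed.

Definition splice : proj_resolution M :=
  ProjResolution splice_projective splice_exact splice_exact0 splice_surj.

End Splice.

(** A resolution of [K] spliced with [F] resolves [M], and the same cocycle then has one degree
    more. *)
Lemma Ext_syzygy (K F M N : lmodType A) (j : {linear K -> F}) (p : {linear F -> M}) :
  projective_module F -> short_exact j p ->
  Ext_positive_vanishes M N -> Ext_positive_vanishes K N.
Proof.
move=> pF jp EM [//|i] _ Q phi phid.
exact: (EM i.+2 isT (splice pF jp Q) phi phid).
Qed.

Record free_cover (M : lmodType A) := FreeCover {
  cover_rank : nat;
  cover_ker : lmodType A;
  cover_in : {linear cover_ker -> 'rV[A]_cover_rank};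
  cover_out : {linear 'rV[A]_cover_rank -> M};
  cover_exact : short_exact cover_in cover_out;
  cover_fg : finitely_generated cover_ker
}.

(** [Ext_vanishes] speaks of all resolutions, so one must exist before anything can be extracted
    from it. Finite generation is carried along in [st], so that the kernel of a cover can be
    covered again. *)
Lemma resolution_exists (M : lmodType A) :
  noetherian A -> finitely_generated M -> inhabited (proj_resolution M).
Proof.
move=> An fM; pose st := {M : lmodType A | finitely_generated M}.
have ex (m : st) : inhabited (free_cover (sval m)).
  have [n [K [j [p [jp fK]]]]] := fg_sub_free_cover An (svalP m).
  by constructor; exact: (FreeCover jp fK).
pose c (m : st) := inhabited_witness (ex m).
pose nx (m : st) : st := exist _ (cover_ker (c m)) (cover_fg (c m)).
pose s i := iter i nx (exist _ M fM).
pose P i : lmodType A := 'rV[A]_(cover_rank (c (s i))).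
pose d i : {linear P i.+1 -> P i} :=
  (cover_in (c (s i)) \o (cover_out (c (s i.+1)) : {linear _ -> cover_ker (c (s i))})
   : {linear _ -> _}).
constructor; apply: (@ProjResolution A M P d (cover_out (c (s 0)))).
- by move=> i; apply: free_projective.
- move=> i y; have [ji _ _] := cover_exact (c (s i)).
  have [_ jE ps] := cover_exact (c (s i.+1)); split=> [|[x <-]].
    rewrite -[X in _ = X -> _](linear0 (cover_in (c (s i)))) => /ji/jE[k <-].
    have [_ _ ps'] := cover_exact (c (s i.+2)).
    by have [x <-] := ps' k; exists x.
  have e : cover_out (c (s i.+1)) (d i.+1 x) = 0 :> cover_ker (c (s i)).
    by apply/jE; exists (cover_out (c (s i.+2)) x).
  exact: etrans (congr1 (cover_in (c (s i))) e) (linear0 _).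
- move=> y; have [_ jE _] := cover_exact (c (s 0)); split=> [/jE[k <-]|[x <-]].
    have [_ _ ps'] := cover_exact (c (s 1)).
    by have [x <-] := ps' k; exists x.
  by apply/jE; exists (cover_out (c (s 1)) x).
- by case: (cover_exact (c (s 0))).
Qed.

(** A map on [K], pulled back to [Q 0], is a cocycle of degree one for the spliced resolution of
    [M]; a map that bounds it is the extension sought. *)
Lemma Ext_extends (K F M N : lmodType A) (j : {linear K -> F}) (p : {linear F -> M}) :
  noetherian A -> finitely_generated K -> projective_module F -> short_exact j p ->
  Ext_positive_vanishes M N -> extends_along N j.
Proof.
move=> An fK pF jp EM phi; have [Q] := resolution_exists An fK.
have [|psi psiE] :=
    EM 1 isT (splice pF jp Q) (phi \o res_aug Q : {linear Q 0 -> N}).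
  by move=> x /=; rewrite (iffRL (res_exact0 _)) ?linear0 //; exists x.
by exists psi => k; have [x <-] := @res_aug_surj _ _ Q k;
  rewrite -[RHS]/((phi \o res_aug Q) x) psiE.
Qed.

(** The class [X] of modules with such a syzygy is closed under syzygies: a free cover of [K']
    inherits both properties from the vanishing over [K']. *)
Lemma Ext_of_syzygy (K F M N : lmodType A) (j : {linear K -> F}) (p : {linear F -> M}) :
  noetherian A -> finitely_generated K -> projective_module F -> short_exact j p ->
  Ext_positive_vanishes K N -> extends_along N j -> Ext_positive_vanishes M N.
Proof.
move=> An fK pF jp EK jN.
pose X (M' : lmodType A) := exists (K' F' : lmodType A) (j' : {linear K' -> F'})
    (p' : {linear F' -> M'}), [/\ finitely_generated K', projective_module F',
    short_exact j' p', Ext_positive_vanishes K' N & extends_along N j'].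
apply: (@Ext_vanishes_class N X); last by exists K, F, j, p.
move=> M' [K' [F' [j' [p' [fK' pF' jp' EK' jN']]]]]; exists K', F', j', p'; split=> //.
have [n [L [i [q [iq fL]]]]] := fg_sub_free_cover An fK'.
exists L, 'rV[A]_n, i, q; split=> //.
- exact: free_projective.
- exact: Ext_syzygy (@free_projective A n) iq EK'.
- exact: Ext_extends An fL (@free_projective A n) iq EK'.
Qed.

Lemma Ext_iso (M M' N : lmodType A) (f : {linear M -> M'}) :
  noetherian A -> finitely_generated M -> bijective f ->
  Ext_positive_vanishes M N -> Ext_positive_vanishes M' N.
Proof.
move=> An fM [g fK gK] EM; have fs y : exists x, f x = y by exists (g y); rewrite gK.
have [n [L [i [q [iq fL]]]]] := fg_sub_free_cover An fM.
have fq : short_exact i (f \o q : {linear _ -> _}).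
  have [ii ie qs] := iq; split=> // [y /=|y].
    by rewrite -ie; split=> [|->]; rewrite ?linear0 // -(linear0 f) => /(can_inj fK).
  by have [x <-] := fs y; have [z <-] := qs x; exists z.
apply: (Ext_of_syzygy An fL (@free_projective A n) fq); last first.
  exact: Ext_extends An fL (@free_projective A n) iq EM.
exact: Ext_syzygy (@free_projective A n) iq EM.
Qed.

(** Comparing [v] with a free cover of [Z] exhibits [Y] as the pushout of [j] along [b : K -> X], so
    an extension [psi] of [phi \o b] glues with [phi] to a map on [Y]. *)
Lemma Ext1_extends (X Y Z N : lmodType A) (u : {linear X -> Y}) (v : {linear Y -> Z}) :
  noetherian A -> finitely_generated Z -> short_exact u v ->
  Ext_positive_vanishes Z N -> extends_along N u.
Proof.
move=> An fZ [ui ue vs] EZ phi.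
have [n [K [j [p [jp fK]]]]] := fg_sub_free_cover An fZ.
have [a aE] := @free_projective A n _ _ v p vs.
have [b bE] : exists b : {linear K -> X}, forall k, u (b k) = a (j k).
  apply: (factor_inj (g := a \o j : {linear _ -> _})) => // k; apply/ue.
  by rewrite /= aE (short_exact_comp0 jp).
have [psi psiE] := Ext_extends An fK (@free_projective A n) jp EZ (phi \o b : {linear _ -> _}).
have [s sE] := @linear_of_fun A ('rV[A]_n * X)%type Y (fun z => a z.1 + u z.2)
  ltac:(by move=> c x y; rewrite /= !linearP scalerDr addrACA).
have [t tE] := @linear_of_fun A ('rV[A]_n * X)%type N (fun z => psi z.1 + phi z.2)
  ltac:(by move=> c x y; rewrite /= !linearP scalerDr addrACA).
have [||h hE] := factor_surj (v := s) (g := t).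
- move=> y; have [_ je ps] := jp; have [z zE] := ps (v y).
  have [x xE] : exists x, u x = y - a z by apply/ue; rewrite linearB aE zE subrr.
  by exists (z, x); rewrite sE /= xE addrC subrK.
(* The kernel of [s] consists of the pairs [(j k, - b k)]. *)
- move=> [z x]; rewrite sE tE /= => E.
  have [_ je _] := jp; have [k kE] : exists k, j k = z.
    apply/je; rewrite -aE; apply/eqP; rewrite -[X in X == _]addr0.
    by rewrite -[X in _ + X](iffRL (ue (u x))) -?linearD ?E ?linear0 //; exists x.
  have -> : x = - b k.
    by apply: ui; rewrite linearN bE kE; apply/eqP; rewrite -addr_eq0 addrC E.
  by rewrite -kE psiE linearN subrr.
by exists h => x; rewrite -[u x]add0r -(linear0 a) -(sE (0, x)) hE tE linear0 add0r.
Qed.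

End Ext.

(** * Gorenstein projective modules *)

Section Duality.
Variable A : comNzRingType.

Lemma lin_fun0 (M N : lmodType A) (f : linHom M N) : lin_fun f 0 = 0.
Proof. exact: linear0 (f : {linear _ -> _}). Qed.

Lemma lin_funD (M N : lmodType A) (f : linHom M N) x y :
  lin_fun f (x + y) = lin_fun f x + lin_fun f y.
Proof. exact: (linearD (f : {linear M -> N})). Qed.

Lemma lin_funZ (M N : lmodType A) (f : linHom M N) a x :
  lin_fun f (a *: x) = a *: lin_fun f x.
Proof. exact: (linearZZ (f : {linear M -> N}) a x). Qed.

Lemma lin_fun_sum (M N : lmodType A) (f : linHom M N) I (r : seq I) P (F : I -> M) :
  lin_fun f (\sum_(i <- r | P i) F i) = \sum_(i <- r | P i) lin_fun f (F i).
Proof. exact: (linear_sum (f : {linear M -> N})). Qed.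

Lemma lin_fun_rows n (N : lmodType A) (f : linHom 'rV[A]_n N) x :
  lin_fun f x = \sum_i x 0 i *: lin_fun f (delta_mx 0 i).
Proof. exact: (linear_row_sum (f : {linear 'rV[A]_n -> N})). Qed.

Lemma dual_map_exists (M N : lmodType A) (f : {linear M -> N}) :
  exists g : {linear dual N -> dual M}, forall h x, lin_fun (g h) x = lin_fun h (f x).
Proof.
have [a x y|g gE] := @linear_of_fun A (dual N) (dual M)
  (fun h => ((h : {linear _ -> _}) \o f : {linear _ -> _})).
  exact: linHomP.
by exists g => h x; rewrite gE.
Qed.

Lemma biduality_linear (M : lmodType A) :
  exists b : {linear M -> dual (dual M)}, forall x, b x = biduality x.
Proof.
apply: linear_of_fun => a x y; apply: linHomP => f.
exact: (linearP (f : {linear M -> A^o})).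
Qed.

Lemma row_functional (n : nat) (v : 'rV[A]_n) :
  exists f : dual ('rV[A]_n : lmodType A), forall x, lin_fun f x = \sum_i x 0 i * v 0 i.
Proof. by have [f fE] := @linear_of_basis A n A^o (v 0); exists f. Qed.

Lemma row_separated (n : nat) (x y : 'rV[A]_n) :
  (forall f : dual ('rV[A]_n : lmodType A), lin_fun f x = lin_fun f y) -> x = y.
Proof.
move=> xy; apply/rowP => i; have [f fE] := row_functional (delta_mx 0 i).
have fi (z : 'rV[A]_n) : \sum_k z 0 k * (delta_mx 0 i : 'rV[A]_n) 0 k = z 0 i.
  by rewrite (bigD1 i) //= mxE !eqxx mulr1 big1 ?addr0 // => k /negbTE ki;
    rewrite mxE ki andbF mulr0.
by move: (xy f); rewrite !fE !fi.
Qed.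

Lemma row_reflexive (n : nat) (t : dual (dual ('rV[A]_n : lmodType A))) :
  exists x : 'rV[A]_n, forall f, lin_fun t f = lin_fun f x.
Proof.
have /choice[e eE] (i : 'I_n) := row_functional (delta_mx 0 i).
exists (\row_i lin_fun t (e i)) => f.
have {1}-> : f = \sum_i lin_fun f (delta_mx 0 i) *: e i.
  apply: linHomP => x.
  rewrite lin_fun_rows.
  have -> : lin_fun (\sum_i lin_fun f (delta_mx 0 i) *: e i) x =
     \sum_i lin_fun (lin_fun f (delta_mx 0 i) *: e i) x.
    by elim/big_ind2: _ => // f1 a1 f2 a2 <- <-.
  apply: eq_bigr => i _.
  rewrite -[RHS]/(lin_fun f (delta_mx 0 i) * lin_fun (e i) x) eE (bigD1 i) //=.
  rewrite mxE !eqxx mulr1 big1 ?addr0 1?mulrC // => k /negbTE ki.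
  by rewrite mxE ki andbF mulr0.
rewrite lin_fun_sum [RHS]lin_fun_rows.
apply: eq_bigr => i _; rewrite lin_funZ mxE.
exact: mulrC.
Qed.

Definition reflexive (M : lmodType A) := bijective (@biduality A M).

Lemma reflexiveP (M : lmodType A) : reflexive M <->
  (forall x y : M, (forall f : dual M, lin_fun f x = lin_fun f y) -> x = y) /\
  (forall t : dual (dual M), exists x, forall f, lin_fun t f = lin_fun f x).
Proof.
split=> [[g bK gK]|[bi bs]].
  split=> [x y xy|t]; last by exists (g t) => f; rewrite -{1}(gK t).
  by apply: (can_inj bK); apply: linHomP => f; apply: xy.
have /choice[g gE] := bs; exists g => [x|t].
  by apply: bi => f; rewrite -gE.
by apply: linHomP => f; rewrite [RHS]gE.
Qed.

(** Evaluation at the generators embeds [dual M] in a free module. *)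
Lemma dual_fg (M : lmodType A) :
  noetherian A -> finitely_generated M -> finitely_generated (dual M).
Proof.
move=> An [n [e eE]].
have [j jE] := @linear_of_fun A (dual M) 'rV[A]_n (fun f => \row_i lin_fun f (e i))
  ltac:(by move=> a f g; apply/rowP => i; rewrite !mxE).
apply: (noetherian_submodule An (j := j)) => f g fg; apply: linHomP => x.
have [c ->] := eE x.
rewrite !lin_fun_sum; apply: eq_bigr => i _; rewrite !lin_funZ.
by move/rowP/(_ i): fg; rewrite !jE !mxE => ->.
Qed.

Definition fg_gorenstein (M : lmodType A) :=
  finitely_generated M /\ gorenstein_projective M.

(** A projective module is covered by itself, with kernel zero. *)
Lemma projective_Ext (P N : lmodType A) :
  projective_module P -> Ext_positive_vanishes P N.
Proof.
move=> pP; apply: (Ext_vanishes_class (X := @projective_module A) _ pP) => M pM.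
have [p pE] := @linear_of_fun A M M idfun (fun _ _ _ => erefl).
have z0 (L : lmodType A) : exists z : {linear 'rV[A]_0 -> L}, forall x, z x = 0.
  by exists (\0 : {linear _ -> _}).
have [j jE] := z0 M.
exists 'rV[A]_0, M, j, p; split=> //.
- split=> [x y _|y|y]; first by apply/rowP; case.
    by rewrite pE /=; split=> [->|[x <-]]; [exists 0; rewrite jE | rewrite jE].
  by exists y; rewrite pE.
- exact: free_projective.
- move=> phi; have [psi psiE] := z0 N.
  exists (\0 : {linear _ -> _}) => k /=.
  by rewrite (_ : k = 0) ?linear0 //; apply/rowP; case.
Qed.

Lemma free_dual_iso (n : nat) :
  exists f : {linear 'rV[A]_n -> dual ('rV[A]_n : lmodType A)},
    bijective f /\ forall v x, lin_fun (f v) x = \sum_i x 0 i * v 0 i.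
Proof.
have /choice[e eE] := @row_functional n.
have [f fE] := @linear_of_fun A 'rV[A]_n (dual ('rV[A]_n : lmodType A)) e
  ltac:(move=> a u v; apply: linHomP => x;
    rewrite -[RHS]/(a * lin_fun (e u) x + lin_fun (e v) x) !eE mulr_sumr -big_split;
    by apply: eq_bigr => i _; rewrite !mxE mulrDr mulrCA).
exists f; split=> [|v x]; last by rewrite fE eE.
exists (fun h : dual ('rV[A]_n : lmodType A) => \row_i lin_fun h (delta_mx 0 i)) => [v|h].
  apply/rowP => i; rewrite mxE fE eE (bigD1 i) //= mxE !eqxx mul1r big1 ?addr0 //.
  by move=> k /negbTE ki; rewrite mxE ki andbF mul0r.
apply: linHomP => x; rewrite fE eE (lin_fun_rows h).
by apply: eq_bigr => i _; rewrite mxE.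
Qed.

Lemma projective_iso (P Q : lmodType A) (f : {linear P -> Q}) :
  bijective f -> projective_module P -> projective_module Q.
Proof.
move=> [g fK gK] pP M N v h vs.
have [k kE] := pP _ _ v (h \o f : {linear _ -> _}) vs.
have [g' g'E] : exists g' : {linear Q -> P}, forall x, f (g' x) = x.
  have [i iE] := @linear_of_fun A Q Q idfun (fun _ _ _ => erefl).
  have [|x|g' E] := factor_inj (j := f) (g := i); first exact: can_inj fK.
    by exists (g x); rewrite gK iE.
  by exists g' => x; rewrite E iE.
by exists (k \o g' : {linear _ -> _}) => x; rewrite /= kE /= g'E.
Qed.

Lemma torsion_free_of_embedding (n : nat) (M : lmodType A)
    (i : {linear M -> 'rV[A]_n}) (a : A) :
  nonzerodivisor a -> injective i -> forall x : M, a *: x = 0 -> x = 0.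
Proof.
move=> ar ii x ax; apply: ii; rewrite linear0; apply/rowP => k; rewrite mxE.
by apply: ar; move: (congr1 i ax); rewrite linearZ linear0 => /rowP/(_ k); rewrite !mxE.
Qed.

Hypothesis An : noetherian A.

Lemma free_gorenstein (n : nat) : fg_gorenstein ('rV[A]_n : lmodType A).
Proof.
split; first exact: fg_free.
split; first exact/projective_Ext/free_projective.
  have [f [fb _]] := free_dual_iso n.
  exact/projective_Ext/(projective_iso fb)/free_projective.
by apply/reflexiveP; split; [exact: row_separated | exact: row_reflexive].
Qed.

Lemma dual_gorenstein (M : lmodType A) : fg_gorenstein M -> fg_gorenstein (dual M).
Proof.
move=> [fM [EM EdM bM]]; split; first exact: dual_fg.
split=> //.
  have [b bE] := biduality_linear M; apply: (Ext_iso An fM (f := b)) => //.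
  by have [g bK gK] := bM; exists g => x; rewrite bE ?bK ?gK.
have [_ bs] := (reflexiveP M).1 bM.
apply/reflexiveP; split=> [f g fg|t].
  by apply: linHomP => x; exact: (fg (biduality x)).
have [b bE] := biduality_linear M.
exists ((t : {linear _ -> _}) \o b : {linear _ -> _}) => xi.
have [x xE] := bs xi.
have -> : xi = biduality x by apply: linHomP => f; rewrite xE.
by rewrite -[RHS]/(lin_fun t (b x)) bE.
Qed.

(** * Syzygies, cosyzygies and embeddings in free modules *)

Section Syzygy.
Variables (n : nat) (K M : lmodType A).
Variables (j : {linear K -> 'rV[A]_n}) (p : {linear 'rV[A]_n -> M}).
Hypotheses (jp : short_exact j p) (GM : fg_gorenstein M).

Let fK : finitely_generated K.
Proof. by case: jp => ji _ _; exact: noetherian_submodule ji. Qed.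

(** Surjectivity of [j'] is the vanishing of [Ext^1(M, A)]; the rest is left exactness of Hom. *)
Lemma dual_short_exact (j' : {linear dual ('rV[A]_n : lmodType A) -> dual K})
   (p' : {linear dual M -> dual ('rV[A]_n : lmodType A)}) :
  (forall h x, lin_fun (j' h) x = lin_fun h (j x)) ->
  (forall h x, lin_fun (p' h) x = lin_fun h (p x)) -> short_exact p' j'.
Proof.
move=> j'E p'E; have [ji je ps] := jp; split.
- move=> f g fg; apply: linHomP => y; have [x <-] := ps y.
  by rewrite -!p'E fg.
- move=> f; split=> [fj|[h <-]].
    have [x|h hE] := factor_surj (g := (f : {linear _ -> _})) ps.
      by move=> /je[k <-]; rewrite -[RHS]/(lin_fun (0 : dual K) k) -fj j'E.
    by exists h; apply: linHomP => x; rewrite p'E -[RHS]hE.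
  apply: linHomP => k; rewrite j'E p'E (short_exact_comp0 jp).
  exact: linear0 (h : {linear _ -> _}).
- move=> f; have [_ [EM _ _]] := GM.
  have [psi psiE] := Ext_extends An fK (@free_projective A n) jp EM f.
  by exists psi; apply: linHomP => k; rewrite j'E; exact: psiE.
Qed.

(** The dual sequence makes [dual M] a syzygy of [dual K], so vanishing for [dual K] follows once
    functionals on [dual M] extend. They do, being evaluations at points of [M] by reflexivity. *)
Lemma syzygy_gorenstein : fg_gorenstein K.
Proof.
have [ji je ps] := jp; have [fM [EM EdM bM]] := GM.
have [bi bs] := (reflexiveP M).1 bM.
have [j' j'E] := dual_map_exists j; have [p' p'E] := dual_map_exists p.
have jp' := dual_short_exact j'E p'E.
split=> //; split.
- exact: Ext_syzygy (@free_projective A n) jp EM.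
- apply: (Ext_of_syzygy An _ _ jp' EdM).
  + exact: dual_fg.
  + by have [f [fb _]] := free_dual_iso n; exact: projective_iso fb (@free_projective A n).
  + move=> phi; have [m mE] := bs phi; have [x xm] := ps m.
    exists (eval_at x : {linear _ -> A^o}) => f.
    by rewrite [RHS](mE f) -xm; exact: p'E.
apply/reflexiveP; split=> [x y xy|t].
  by apply/ji/row_separated => f; rewrite -!j'E.
(* On the free module [t] is evaluation at some [x]. Every functional of [M] takes [p x] to zero,
   since [j'] kills the image of [p']; hence [x] lies in [K]. *)
have [x xE] := row_reflexive ((t : {linear _ -> _}) \o j' : {linear _ -> _}).
have [k kE] : exists k, j k = x.
  apply/je/bi => f; rewrite -p'E -xE /lin_fun /=.
  rewrite (short_exact_comp0 jp') linear0.
  by rewrite -/(lin_fun f 0) /lin_fun linear0.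
exists k => f; have [_ _ js] := jp'; have [g <-] := js f.
by rewrite j'E kE -xE.
Qed.

End Syzygy.

(* The cokernel is the dual of the kernel of [j^*], as [M] is reflexive. *)
Lemma cosyzygy_gorenstein (n : nat) (M : lmodType A) (j : {linear M -> 'rV[A]_n}) :
  fg_gorenstein M -> injective j ->
  (forall f : dual M, exists g : dual ('rV[A]_n : lmodType A),
     forall x, lin_fun g (j x) = lin_fun f x) ->
  exists (Z : lmodType A) (v : {linear 'rV[A]_n -> Z}),
    short_exact j v /\ fg_gorenstein Z.
Proof.
move=> GM ji js; have [f [fb fE]] := free_dual_iso n.
have [j' j'E] := dual_map_exists j.
pose q := (j' \o f : {linear 'rV[A]_n -> dual M}).
have [g fK gK] := fb.
have qs h : exists x, q x = h.
  have [h' h'E] := js h; exists (g h'); rewrite /q /= gK.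
  by apply: linHomP => x; rewrite j'E h'E.
have [L [i [ii iE]]] := kernel_exists q.
have iq : short_exact i q by [].
have GdM := dual_gorenstein GM.
have GL := syzygy_gorenstein iq GdM.
have [i' i'E] := dual_map_exists i.
pose v := (i' \o f : {linear 'rV[A]_n -> dual L}).
exists (dual L), v; split; last exact: dual_gorenstein.
have vE x l : lin_fun (v x) l = \sum_k i l 0 k * x 0 k by rewrite /v /= i'E fE.
have [_ [_ _ bM]] := GM; have [_ bs] := (reflexiveP M).1 bM.
split=> //.
- move=> x; split=> [vx|[m <-]].
    (* [f x] vanishes on [L], so it descends to a functional on [dual M], that is, evaluation at
       some [m]; symmetry of the pairing gives [j m = x]. *)
    have [y|t tE] := factor_surj (g := (f x : {linear _ -> _})) qs.
      by move=> /iE[l <-]; rewrite -[LHS]/(lin_fun (f x) (i l)) -i'E -[i' _]/(v x) vx.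
    have [m mE] := bs t; exists m; apply: row_separated => h.
    rewrite -[h]gK; move: (g h) => {}h; rewrite !fE.
    have := tE h; rewrite -/(lin_fun t _) mE /q /= j'E fE => ->.
    rewrite -/(lin_fun (f x) h) fE; apply: eq_bigr => k _; exact: mulrC.
  apply: linHomP => l; rewrite vE.
  have /iE/(congr1 (fun h => lin_fun h m)) : exists l', i l' = i l by exists l.
  by rewrite /q /= j'E fE => E; rewrite -[RHS]E; apply: eq_bigr => k _; exact: mulrC.
- move=> t; have [_ [EdM _ _]] := GdM.
  have [psi psiE] := Ext_extends An GL.1 (@free_projective A n) iq EdM t.
  exists (g psi); apply: linHomP => l.
  by rewrite /v /= i'E gK; exact: psiE.
Qed.

(** The coordinates are generators of the dual. They separate points because [M] is reflexive, and
    every functional is a combination of them, hence extends. *)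
Lemma gorenstein_embedding (M : lmodType A) : fg_gorenstein M ->
  exists (n : nat) (i : {linear M -> 'rV[A]_n}), injective i /\
    forall f : dual M, exists g : dual ('rV[A]_n : lmodType A),
      forall x, lin_fun g (i x) = lin_fun f x.
Proof.
move=> [fM [_ _ bM]]; have [bi _] := (reflexiveP M).1 bM.
have [n [e eE]] := dual_fg An fM.
have [i iE] := @linear_of_fun A M 'rV[A]_n (fun x => \row_k lin_fun (e k) x)
  ltac:(by move=> a x y; apply/rowP => k; rewrite !mxE;
    exact: (linearP (e k : {linear M -> A^o}))).
have i_onto f : exists g : dual ('rV[A]_n : lmodType A),
    forall x, lin_fun g (i x) = lin_fun f x.
  have [c ->] := eE f; have [g gE] := row_functional (\row_k c k).
  exists g => x; rewrite gE.
  have -> : lin_fun (\sum_k c k *: e k) x = \sum_k lin_fun (c k *: e k) x.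
    by elim/big_ind2: _ => // f1 a1 f2 a2 <- <-.
  by apply: eq_bigr => k _; rewrite iE !mxE mulrC.
exists n, i; split=> // x y xy; apply: bi => f.
by have [g gE] := i_onto f; rewrite -!gE xy.
Qed.

Lemma gorenstein_torsion_free (M : lmodType A) (a : A) :
  nonzerodivisor a -> fg_gorenstein M -> forall x : M, a *: x = 0 -> x = 0.
Proof.
move=> ar /gorenstein_embedding[n [i [ii _]]].
exact: torsion_free_of_embedding ii.
Qed.

End Duality.

(** * Change of rings *)

Section ChangeOfRings.
Variables (S R : comNzRingType) (phi : {rmorphism S -> R}) (w : S).
Hypotheses (phi_surj : forall r, exists s, phi s = r)
  (phi_ker : forall s, phi s = 0 <-> exists a, s = a * w)
  (w_reg : nonzerodivisor w) (Sn : noetherian S).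

Local Notation "x ^r" := (map_mx phi x) (at level 2, format "x ^r").

Lemma noetherian_quotient : noetherian R.
Proof.
move=> I [I0 ID IM].
have [|n [e eE]] := Sn (I := [set s | I (phi s)]%classic).
  split=> [|x y Ix Iy|a x Ix] /=; first by rewrite rmorph0.
    by rewrite rmorphD; apply: ID.
  by rewrite rmorphM; apply: IM.
exists n, (phi \o e) => x; have [s <-] := phi_surj x; split=> [/eE[c ->]|[c cE]].
  by exists (phi \o c); rewrite rmorph_sum; apply: eq_bigr => i _; rewrite rmorphM.
have /choice[d dE] i := phi_surj (c i); rewrite cE.
have -> : \sum_i c i * (phi \o e) i = phi (\sum_i d i * e i).
  by rewrite rmorph_sum; apply: eq_bigr => i _; rewrite rmorphM dE.
by apply/eE; exists d.
Qed.

Let Rn := noetherian_quotient.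

Lemma phi_w : phi w = 0.
Proof. by apply/phi_ker; exists 1; rewrite mul1r. Qed.

Lemma red_mapZ n (a : S) (x : 'rV[S]_n) : (a *: x)^r = phi a *: x^r.
Proof. exact: map_mxZ. Qed.

Lemma red_surj n (y : 'rV[R]_n) : exists x, x^r = y.
Proof.
have /choice[d dE] i := phi_surj (y 0 i); exists (\row_i d i).
by apply/rowP => i; rewrite !mxE.
Qed.

Lemma red_ker n (x : 'rV[S]_n) : x^r = 0 -> exists z, w *: z = x.
Proof.
move=> x0; have /choice[d dE] i : exists a, x 0 i = a * w.
  by apply/phi_ker; move/rowP/(_ i): x0; rewrite !mxE.
by exists (\row_i d i); apply/rowP => i; rewrite !mxE dE mulrC.
Qed.

Lemma scale_w_inj n : injective (fun x : 'rV[S]_n => w *: x).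
Proof.
move=> x y xy; apply/rowP => i; apply/eqP; rewrite -subr_eq0; apply/eqP/w_reg.
by move/rowP/(_ i): xy; rewrite !mxE mulrBr => ->; rewrite subrr.
Qed.

Lemma red_map_w n (x : 'rV[S]_n) : (w *: x)^r = 0.
Proof. by rewrite red_mapZ phi_w scale0r. Qed.

Lemma reduce_functional n (g : {linear 'rV[S]_n -> S^o}) :
  exists g' : {linear 'rV[R]_n -> R^o}, forall x, g' x^r = phi (g x).
Proof.
have [g' g'E] := @linear_of_basis R n R^o (fun i => phi (g (delta_mx 0 i))).
exists g' => x; rewrite g'E linear_row_sum rmorph_sum.
by apply: eq_bigr => i _; rewrite rmorphM !mxE.
Qed.

Lemma lift_functional n (g' : {linear 'rV[R]_n -> R^o}) :
  exists g : {linear 'rV[S]_n -> S^o}, forall x, phi (g x) = g' x^r.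
Proof.
have /choice[e eE] i := phi_surj (g' (delta_mx 0 i)).
have [g gE] := @linear_of_basis S n S^o e; exists g => x.
rewrite gE [RHS]linear_row_sum rmorph_sum.
by apply: eq_bigr => i _; rewrite rmorphM !mxE eE.
Qed.

Lemma divide_functional (N : lmodType S) (g : {linear N -> S^o}) :
  (forall x, phi (g x) = 0) -> exists h : {linear N -> S^o}, forall x, w * h x = g x.
Proof.
move=> g0; pose W := (w \*: idfun : {linear S^o -> S^o}).
have [x y /= xy|x|h hE] := factor_inj (j := W) (g := g).
- apply/eqP; rewrite -subr_eq0; apply/eqP/w_reg.
  by rewrite mulrBr; apply/eqP; rewrite subr_eq0; apply/eqP.
- by have [a aE] := (phi_ker (g x)).1 (g0 x); exists a; rewrite aE; exact: mulrC.
- by exists h.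
Qed.

Lemma red_row_sum n k (x : 'rV[S]_n) (F : 'I_n -> 'rV[S]_k) :
  (\sum_i x 0 i *: F i)^r = \sum_i x^r 0 i *: (F i)^r.
Proof. by rewrite map_mx_sum; apply: eq_bigr => i _; rewrite red_mapZ !mxE. Qed.

Lemma reduce_linear n k (g : {linear 'rV[S]_n -> 'rV[S]_k}) :
  exists g' : {linear 'rV[R]_n -> 'rV[R]_k}, forall x, g' x^r = (g x)^r.
Proof.
have [g' g'E] := linear_of_basis (fun i => (g (delta_mx 0 i))^r).
by exists g' => x; rewrite g'E [in RHS]linear_row_sum red_row_sum.
Qed.

Lemma lift_linear n k (g' : {linear 'rV[R]_n -> 'rV[R]_k}) :
  exists g : {linear 'rV[S]_n -> 'rV[S]_k}, forall x, (g x)^r = g' x^r.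
Proof.
have /choice[e eE] i := red_surj (g' (delta_mx 0 i)).
have [g gE] := linear_of_basis e; exists g => x.
rewrite gE [RHS]linear_row_sum red_row_sum.
by apply: eq_bigr => i _; rewrite eE.
Qed.

(* [K] is, over [S], the kernel of the composite of the reduction
   [S^n -> R^n] and [p : R^n -> M]. *)
Definition presents (K : lmodType S) (n : nat) (j : {linear K -> 'rV[S]_n})
    (M : lmodType R) (p : {linear 'rV[R]_n -> M}) : Prop :=
  [/\ injective j, forall x, p x^r = 0 <-> exists k, j k = x
    & forall y, exists x, p x = y].

Lemma presents_exists n (M : lmodType R) (p : {linear 'rV[R]_n -> M}) :
  (forall y, exists x, p x = y) ->
  exists (K : lmodType S) (j : {linear K -> 'rV[S]_n}), presents j p.
Proof.
move=> ps; have [|a x y px py|K [j [ji jE]]] :=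
  @submodule_exists S 'rV[S]_n (fun x => p x^r = 0).
- by rewrite map_mx0 linear0.
- by rewrite map_mxD red_mapZ linearP px py scaler0 addr0.
by exists K, j.
Qed.

Lemma presents_w (K : lmodType S) n (j : {linear K -> 'rV[S]_n})
    (M : lmodType R) (p : {linear 'rV[R]_n -> M}) : presents j p ->
  exists f : {linear 'rV[S]_n -> K}, forall x, j (f x) = w *: x.
Proof.
move=> [ji jE _].
have [x|f fE] := factor_inj (j := j) (g := w \*: idfun : {linear 'rV[S]_n -> 'rV[S]_n}) ji.
  by apply/jE; rewrite red_map_w linear0.
by exists f.
Qed.

Section Presented.
Variables (K : lmodType S) (n : nat) (j : {linear K -> 'rV[S]_n}).
Variables (M : lmodType R) (p : {linear 'rV[R]_n -> M}).
Hypotheses (jp : presents j p) (GM : fg_gorenstein M).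

Lemma presented_fg : finitely_generated K.
Proof. by case: jp => ji _ _; exact: noetherian_submodule ji. Qed.

(* A presented module has a syzygy presenting the syzygy [L] of [M]; functionals
   extend from it because those of [L] extend to [R^n]. *)
Lemma presented_syzygy : exists (K' P : lmodType S) (i : {linear K' -> P})
    (q : {linear P -> K}),
  [/\ projective_module P, short_exact i q,
      exists (m : nat) (k : {linear K' -> 'rV[S]_m}) (L : lmodType R)
        (r : {linear 'rV[R]_m -> L}), presents k r /\ fg_gorenstein L
    & extends_along S^o i].
Proof.
have [ji jE ps] := jp; have [f' f'E] := presents_w jp.
have [L [l [li lE]]] := kernel_exists p.
have lp : short_exact l p by [].
have GL := syzygy_gorenstein Rn lp GM.
have /fgP[m [r rs]] := GL.1.
have [K' [k kr]] := presents_exists rs; have [ki kE _] := kr.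
have [f1 f1E] := presents_w kr.
have [c0 c0E] := lift_linear (l \o r : {linear _ -> _}).
have [c cE] : exists c : {linear 'rV[S]_m -> K}, forall y, j (c y) = c0 y.
  apply: factor_inj => // y; apply/jE; rewrite c0E /=.
  exact: short_exact_comp0 lp _.
(* [c0 \o k] reduces to zero because [K'] lies over the kernel of [r]; [a] is its quotient by
   [w]. *)
have [a aE] : exists a : {linear K' -> 'rV[S]_n}, forall y, w *: a y = c0 (k y).
  pose W := (w \*: idfun : {linear 'rV[S]_n -> 'rV[S]_n}).
  apply: (@factor_inj S _ _ _ W (c0 \o k : {linear _ -> _})); first exact: scale_w_inj.
  move=> y; apply: red_ker; rewrite /= c0E /=.
  by have /kE-> : exists z, k z = k y; [exists y | rewrite linear0].
have [i iE] := @linear_of_fun S K' 'rV[S]_(n + m) (fun y => row_mx (- a y) (k y))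
  ltac:(by move=> s x y; rewrite /= !linearP scale_row_mx add_row_mx).
have [q qE] := @linear_of_fun S 'rV[S]_(n + m) K (fun z => f' (lsubmx z) + c (rsubmx z))
  ltac:(by move=> s x y; rewrite /= !linearP /= scalerDr addrACA).
have jq z : j (q z) = w *: lsubmx z + c0 (rsubmx z) by rewrite qE linearD f'E cE.
exists K', 'rV[S]_(n + m), i, q; split.
- exact: free_projective.
- split=> [x y|z|z].
  + by rewrite !iE => /eq_row_mx[_ /ki].
  + split=> [qz|[y <-]].
      have e : w *: lsubmx z + c0 (rsubmx z) = 0 by rewrite -jq qz linear0.
      have [y yE] : exists y, k y = rsubmx z.
        apply/kE/li; rewrite linear0 -[LHS]/((l \o r) _) -c0E -[RHS](map_mx0 phi).
        by rewrite -e map_mxD red_map_w add0r.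
      exists y; rewrite iE -[RHS]hsubmxK yE; congr row_mx.
      apply: (@scale_w_inj n); rewrite scalerN aE yE.
      by apply/eqP; rewrite eq_sym -addr_eq0 e.
    by apply: ji; rewrite jq iE row_mxKl row_mxKr linear0 scalerN aE addNr.
  + have [u uE] : exists u, l u = (j z)^r.
      by apply/lE/jE; exists z.
    have [v vE] := rs u; have [y yv] := red_surj v.
    have [|x xE] := red_ker (x := j z - c0 y).
      by rewrite map_mxB c0E yv /= vE uE subrr.
    exists (row_mx x y); apply: ji; rewrite jq row_mxKl row_mxKr xE.
    by rewrite subrK.
- by exists m, k, L, r.
(* [g \o f1] reduces to a functional on [R^m] that factors as [h] on [L], and [h] extends to [t'] on
   [R^n]. The lift [t] of [t'] makes [g \o f1 - t \o c0] divisible by [w], with quotient [s]; the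
   functional given by [- t] and [s] restricts to [g], as is checked after multiplication by [w]. *)
move=> g; have f1k x : f1 (k x) = w *: x by apply: ki; rewrite f1E linearZ.
have [g' g'E] := reduce_functional (g \o f1 : {linear _ -> S^o}).
have [y|h hE] := factor_surj (g := g') rs.
  have [x <-] := red_surj y => /kE[z <-].
  by rewrite g'E /= f1k linearZ rmorphM phi_w mul0r.
have [_ [EM _ _]] := GM.
have [t' t'E] := Ext_extends Rn GL.1 (@free_projective R n) lp EM h.
have [t tE] := lift_functional t'.
have [y|s sE] := divide_functional (g := (g \o f1) \- (t \o c0)).
  by rewrite /= rmorphB tE c0E /= t'E hE g'E subrr.
have [u uE] := @linear_of_fun S 'rV[S]_(n + m) S^o (fun z => s (rsubmx z) - t (lsubmx z))
  ltac:(by move=> d x y; rewrite /= !linearP /= scalerDr addrACA).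
exists u => x; rewrite uE iE row_mxKl row_mxKr linearN opprK.
apply/eqP; rewrite -subr_eq0; apply/eqP/w_reg.
rewrite mulrBr mulrDr sE /= f1k -aE (linearZZ g) (linearZZ t).
by rewrite -[w *: g x]/(w * g x) -[w *: t _]/(w * t (a x)) subrK subrr.
Qed.

End Presented.

Lemma presented_Ext (K : lmodType S) n (j : {linear K -> 'rV[S]_n})
    (M : lmodType R) (p : {linear 'rV[R]_n -> M}) :
  presents j p -> fg_gorenstein M -> Ext_positive_vanishes K S^o.
Proof.
move=> jp GM.
pose X (K : lmodType S) := exists n (j : {linear K -> 'rV[S]_n}) (M : lmodType R)
  (p : {linear 'rV[R]_n -> M}), presents j p /\ fg_gorenstein M.
apply: (Ext_vanishes_class (X := X)); last by exists n, j, M, p.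
move=> K1 [n1 [j1 [M1 [p1 [jp1 GM1]]]]].
by have [K' [P [i [q H]]]] := presented_syzygy jp1 GM1; exists K', P, i, q.
Qed.

(* The dual of a module presenting [M] presents the dual of the syzygy of [M]. *)
Lemma presented_dual (K : lmodType S) n (j : {linear K -> 'rV[S]_n})
    (M : lmodType R) (p : {linear 'rV[R]_n -> M}) :
  presents j p -> fg_gorenstein M ->
  exists (j' : {linear dual K -> 'rV[S]_n}) (M' : lmodType R)
    (p' : {linear 'rV[R]_n -> M'}), presents j' p' /\ fg_gorenstein M'.
Proof.
move=> jp GM; have [ji jE ps] := jp; have [f fE] := presents_w jp.
have fj k : f (j k) = w *: k by apply: ji; rewrite fE linearZ.
have [L [l [li lE]]] := kernel_exists p.
have lp : short_exact l p by [].
have GL := syzygy_gorenstein Rn lp GM.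
have [f' f'E] := dual_map_exists f; have [l' l'E] := dual_map_exists l.
have [dS [dSb dSE]] := @free_dual_iso S n; have [dR [dRb dRE]] := @free_dual_iso R n.
have [gS dSK gSK] := dSb; have [gR dRK gRK] := dRb.
(* [dual K] embeds in [S^n] by composition with [f : S^n -> K], under the self-duality of [S^n]. *)
have [b bE] : exists b : {linear dual K -> 'rV[S]_n}, forall h, dS (b h) = f' h.
  by apply: factor_inj => [|h]; [exact: can_inj dSK | exists (gS (f' h))].
have red v x : lin_fun (dR v^r) x^r = phi (lin_fun (dS v) x).
  rewrite dRE dSE rmorph_sum; apply: eq_bigr => i _.
  by rewrite rmorphM !mxE.
exists b, (dual L), (l' \o dR : {linear _ -> _}); split; last exact: dual_gorenstein.
split.
- move=> h1 h2 /(congr1 dS); rewrite !bE => e; apply: linHomP => k.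
  have /(_ (j k)) : forall x, lin_fun (f' h1) x = lin_fun (f' h2) x by rewrite e.
  rewrite !f'E fj !lin_funZ => wk.
  apply/eqP; rewrite -subr_eq0; apply/eqP/w_reg.
  by rewrite mulrBr; apply/eqP; rewrite subr_eq0; apply/eqP.
- move=> v; split=> [lv|[h <-]] /=.
    (* Vanishing on [L] after reduction makes [dS v] divisible by [w] on [K]. The quotient [h]
       satisfies [h \o f = dS v], because [j \o f] is multiplication by [w]. *)
    have [k|h hE] := divide_functional (g := ((dS v : {linear _ -> S^o}) \o j)).
      have [u uE] : exists u, l u = (j k)^r by apply/lE/jE; exists k.
      by rewrite -[LHS]/(phi (lin_fun (dS v) (j k))) -red -uE -l'E [l' _]lv.
    exists h; apply: (can_inj dSK); rewrite bE; apply: linHomP => x.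
    rewrite f'E; apply/eqP; rewrite -subr_eq0; apply/eqP/w_reg.
    rewrite mulrBr [X in X - _](hE (f x)) /= fE -[dS v _]/(lin_fun (dS v) _) lin_funZ.
    exact: subrr.
  apply: linHomP => u; rewrite l'E; have [x xE] := red_surj (l u); rewrite -xE red.
  rewrite bE f'E; have /jE[k kx] : p x^r = 0 by rewrite xE (short_exact_comp0 lp).
  by rewrite -kx fj lin_funZ rmorphM phi_w mul0r.
- move=> h; have [_ [EM _ _]] := GM.
  have [t tE] := Ext_extends Rn GL.1 (@free_projective R n) lp EM h.
  exists (gR t) => /=; apply: linHomP => u; rewrite l'E gRK; exact: tE.
Qed.

(** For reflexivity, functionals on [K] extend to [S^n] after multiplication by [w]. So an element
    of the bidual is matched with a point of [S^n], this point is shown to lie in [K], and [w] is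
    cancelled at the end. *)
Lemma presented_gorenstein (K : lmodType S) n (j : {linear K -> 'rV[S]_n})
    (M : lmodType R) (p : {linear 'rV[R]_n -> M}) :
  presents j p -> fg_gorenstein M -> fg_gorenstein K.
Proof.
move=> jp GM; have [ji jE ps] := jp; split; first exact: presented_fg jp.
split; first exact: presented_Ext jp GM.
  by have [j' [M' [p' [jp' GM']]]] := presented_dual jp GM; exact: presented_Ext jp' GM'.
have [_ [_ _ bM]] := GM; have [bi _] := (reflexiveP M).1 bM.
have [f fE] := presents_w jp; have [j' j'E] := dual_map_exists j.
have fj k : f (j k) = w *: k by apply: ji; rewrite fE linearZ.
apply/reflexiveP; split=> [x y xy|t].
  by apply/ji/row_separated => h; rewrite -!j'E.
have [x xE] := row_reflexive ((t : {linear _ -> _}) \o j' : {linear _ -> _}).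
have {}xE h : lin_fun t (j' h) = lin_fun h x by rewrite -xE.
have wK (h : dual K) : exists g, j' g = w *: h.
  by exists ((h : {linear _ -> _}) \o f : {linear _ -> _}); apply: linHomP => k;
    rewrite j'E -[LHS]/(lin_fun h (f (j k))) fj lin_funZ.
(* Test [p x^r = 0] by functionals [h] of [M]: a lift [g] of [h \o p] takes [K] into multiples of
   [w], so [t (j' g)], which equals [g x], is a multiple of [w] and reduces to zero. *)
have [k kx] : exists k, j k = x.
  apply/jE/bi => h; rewrite lin_fun0.
  have [g gE] := lift_functional ((h : {linear _ -> _}) \o p : {linear _ -> R^o}).
  have [k|u uE] := divide_functional (g := (g \o j)).
    rewrite gE /=; have /jE-> : exists k', j k' = j k by exists k.
    exact: (lin_fun0 h).
  rewrite -[LHS]gE -[g x]/(lin_fun (g : dual _) x) -xE.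
  have -> : j' g = w *: (u : dual K) by apply: linHomP => k; rewrite j'E -[LHS]uE.
  by rewrite lin_funZ rmorphM phi_w mul0r.
exists k => h; apply/eqP; rewrite -subr_eq0; apply/eqP/w_reg.
rewrite mulrBr -[w * lin_fun t h]/(w *: lin_fun t h) -lin_funZ.
have [g gE] := wK h; rewrite -gE xE -kx -j'E gE.
exact: subrr.
Qed.

End ChangeOfRings.

(** * The Frobenius categories *)

Section GprojFrobenius.
Variable A : comNzRingType.
Hypothesis An : noetherian A.

Definition gproj_of (M : lmodType A) (G : fg_gorenstein M) : gproj A :=
  Gproj G.1 G.2.

Lemma gprojP (M : gproj A) : fg_gorenstein M.
Proof. by split; [exact: gmod_fg | exact: gmod_gp]. Qed.

Definition gproj_free (n : nat) : gproj A := gproj_of (free_gorenstein A n).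

(** Each coordinate extends because [Ext^1(Z, A)] vanishes. *)
Lemma gproj_conflation_extends (X Y Z : gproj A) (u : linHom X Y) (v : linHom Y Z) n :
  short_exact (lin_fun u) (lin_fun v) ->
  extends_along 'rV[A]_n (u : {linear X -> Y}).
Proof.
move=> uv f; have [fZ [EZ _ _]] := gprojP Z.
have uE := Ext1_extends An fZ (u := (u : {linear X -> Y}))
  (v := (v : {linear Y -> Z})) uv EZ.
have /choice[g gE] (i : 'I_n) : exists g : {linear Y -> A^o},
    forall x, g (lin_fun u x) = f x 0 i.
  have [c cE] := @linear_of_fun A X A^o (fun x => f x 0 i)
    ltac:(by move=> a x y; rewrite /= linearP !mxE).
  by have [g gE] := uE c; exists g => x; rewrite -cE -gE.
have [k kE] := @linear_of_fun A Y 'rV[A]_n (fun y => \row_i g i y)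
  ltac:(by move=> a x y; apply/rowP => i; rewrite !mxE linearP).
by exists k => x; apply/rowP => i; rewrite kE mxE -gE.
Qed.

Lemma gproj_free_projective n : projective (gproj_free n : GprojCat A).
Proof.
move=> X Y Z u v [_ _ vs] h.
have [k kE] := free_lift (n := n) (g := (v : {linear Y -> Z}))
  (h := (h : {linear 'rV[A]_n -> Z})) (fun x => vs _).
by exists (k : linHom 'rV[A]_n Y); apply: linHomP => x; exact: kE.
Qed.

Lemma gproj_free_injective n : injective_obj (gproj_free n : GprojCat A).
Proof.
move=> X Y Z u v uv h.
have [k kE] := gproj_conflation_extends uv (h : {linear X -> 'rV[A]_n}).
by exists (k : linHom Y 'rV[A]_n); apply: linHomP => x; exact: kE.
Qed.

Lemma gproj_free_cover (M : gproj A) : exists (K : gproj A) (n : nat)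
  (u : linHom K (gproj_free n)) (v : linHom (gproj_free n) M),
  short_exact (lin_fun u) (lin_fun v).
Proof.
have [n [K [j [p [jp _]]]]] := fg_sub_free_cover An (gmod_fg M).
by exists (gproj_of (syzygy_gorenstein An jp (gprojP M))), n, j, p.
Qed.

Lemma GprojCat_frobenius : frobenius_like (GprojCat A).
Proof.
split.
- move=> X Y Z u v uv; apply: linHomP => x.
  exact: (short_exact_comp0 (f := (u : {linear X -> Y})) (g := (v : {linear Y -> Z})) uv).
- move=> X Y Z W u v g [_ _ vs] gv; apply: linHomP => z.
  by have [y <-] := vs z; exact: (congr1 (fun h => lin_fun h y) gv).
- move=> X Y Z W u v g [_ ue vs] gu.
  have [y|h hE] := factor_surj (v := (v : {linear Y -> Z})) (g := (g : {linear Y -> W})) vs.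
    by move=> /ue[x <-]; exact: (congr1 (fun h => lin_fun h x) gu).
  by exists (h : linHom Z W); apply: linHomP => y; exact: hE.
- move=> P pP; have [K [n [u [v uv]]]] := gproj_free_cover P.
  have [s vs] := pP _ _ _ u v uv (idm P).
  exact: retract_injective vs (@gproj_free_injective n).
- move=> X; have [n [i [ii ie]]] := gorenstein_embedding An (gprojP X).
  have [Z [v [iv GZ]]] := cosyzygy_gorenstein An (gprojP X) ii ie.
  exists (gproj_free n), (gproj_of GZ), i, v; split=> //.
  exact: gproj_free_projective.
Qed.

End GprojFrobenius.

(** * The category of monomorphisms and its projective-injective objects *)

Section Mon.
Variables (S : comNzRingType) (w : S).
Hypotheses (w_reg : nonzerodivisor w) (Sn : noetherian S).

Definition mon_in (X : mon w) : {linear mon1 X -> mon0 X} := mon_map X.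

Lemma mon_in_inj (X : mon w) : injective (mon_in X).
Proof. exact: mon_inj. Qed.

(** [mon_in] and this map compose to [w] in both orders, as in a matrix factorization. *)
Lemma mon_back_exists (X : mon w) :
  exists b : {linear mon0 X -> mon1 X}, forall y, mon_in X (b y) = w *: y.
Proof.
have [x|b bE] := factor_inj (g := w \*: idfun : {linear mon0 X -> mon0 X}) (@mon_in_inj X).
  by have [y yE] := mon_coker x; exists y.
by exists b.
Qed.

Lemma mon_back_in (X : mon w) (b : {linear mon0 X -> mon1 X}) :
  (forall y, mon_in X (b y) = w *: y) -> forall x, b (mon_in X x) = w *: x.
Proof. by move=> bE x; apply: mon_in_inj; rewrite bE linearZ. Qed.

Lemma mh_in (X Y : mon w) (f : monHom X Y) x :
  lin_fun (mh0 f) (mon_in X x) = mon_in Y (lin_fun (mh1 f) x).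
Proof. exact: (esym (congr1 (fun h => lin_fun h x) (mh_comm f))). Qed.

(** Injectivity of [mon_in] forces the component on [mon1], so morphisms are compared, and below
    also built, on [mon0] alone. *)
Lemma monHom_eq (X Y : mon w) (f g : monHom X Y) :
  (forall x, lin_fun (mh0 f) x = lin_fun (mh0 g) x) -> f = g.
Proof.
move=> fg; apply: monHomP; last exact: linHomP.
by apply: linHomP => x; apply: (@mon_in_inj Y); rewrite -!mh_in.
Qed.

Lemma monHom_exists (X Y : mon w) (g : {linear mon0 X -> mon0 Y}) :
  (forall x, exists y, mon_in Y y = g (mon_in X x)) ->
  exists f : monHom X Y, forall x, lin_fun (mh0 f) x = g x.
Proof.
move=> gin.
have [h hE] := factor_inj (g := g \o mon_in X : {linear _ -> _}) (@mon_in_inj Y) gin.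
have c : lin_comp (mon_map Y) (h : linHom _ _) = lin_comp (g : linHom _ _) (mon_map X).
  by apply: linHomP => x; exact: hE.
by exists (MonHom c).
Qed.

Section Std.
Variables a b : nat.
Local Notation F := 'rV[S]_(a + b).

Definition std_fun (x : F) : F := row_mx (lsubmx x) (w *: rsubmx x).

Lemma std_fun_linear : linear std_fun.
Proof.
move=> c x y; rewrite /std_fun !linearP /= scale_row_mx add_row_mx.
by congr row_mx; rewrite scalerDr !scalerA mulrC.
Qed.

HB.instance Definition _ := GRing.isLinear.Build S F F _ std_fun std_fun_linear.

Lemma std_fun_inj : injective std_fun.
Proof.
move=> x y /eq_row_mx[l /(scale_w_inj w_reg) r].
by rewrite -[x]hsubmxK -[y]hsubmxK l r.
Qed.

Lemma std_fun_w (y : F) : std_fun (row_mx (w *: lsubmx y) (rsubmx y)) = w *: y.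
Proof. by rewrite /std_fun row_mxKl row_mxKr -scale_row_mx hsubmxK. Qed.

(* The sum of a copies of [S = S] and b copies of [w : S -> S]. *)
Definition std : mon w :=
  @Mon S w (gproj_free S (a + b)) (gproj_free S (a + b))
    (std_fun : {linear F -> F}) std_fun_inj (fun y => ex_intro _ _ (std_fun_w y)).

(** Morphisms from [S = S] to [Y] are elements of [mon1 Y], those from [w : S -> S] elements of
    [mon0 Y]. The deflation is surjective on both components, so each kind lifts. *)
Lemma std_projective : projective (std : MonCat w).
Proof.
move=> X Y Z u v [[_ _ v1s] [_ _ v0s]] h.
have [inl inlE] := @linear_of_fun S 'rV[S]_a F (fun x => row_mx x 0)
  ltac:(by move=> c x y; rewrite /= scale_row_mx add_row_mx scaler0 addr0).
have [inr inrE] := @linear_of_fun S 'rV[S]_b F (fun x => row_mx 0 x)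
  ltac:(by move=> c x y; rewrite /= scale_row_mx add_row_mx scaler0 addr0).
have [al alE] := free_lift (g := (mh1 v : {linear _ -> _}))
  (h := (mh1 h : {linear F -> mon1 Z}) \o inl : {linear _ -> _}) (fun x => v1s _).
have [be beE] := free_lift (g := (mh0 v : {linear _ -> _}))
  (h := (mh0 h : {linear F -> mon0 Z}) \o inr : {linear _ -> _}) (fun x => v0s _).
have [bk bkE] := mon_back_exists Y.
have [k0 k0E] := @linear_of_fun S F (mon0 Y)
   (fun z => mon_in Y (al (lsubmx z)) + be (rsubmx z))
   ltac:(by move=> c x y; rewrite /= !linearP /= scalerDr addrACA).
have [|k kE] := @monHom_exists std Y k0.
  move=> x; exists (al (lsubmx x) + bk (be (rsubmx x))).
  by rewrite k0E /mon_in /= /std_fun row_mxKl row_mxKr linearD linearZ bkE.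
exists k; apply: monHom_eq => z.
rewrite -[LHS]/(lin_fun (mh0 v) (lin_fun (mh0 k) z)) kE k0E lin_funD mh_in.
rewrite [lin_fun (mh1 v) _]alE [lin_fun (mh0 v) _]beE /= inlE inrE.
rewrite -[mh1 h _]/(lin_fun (mh1 h) _) -mh_in -[mh0 h _]/(lin_fun (mh0 h) _) -lin_funD.
congr (lin_fun _ _).
rewrite /mon_in /= /std_fun row_mxKl row_mxKr scaler0 add_row_mx addr0 add0r.
exact: hsubmxK.
Qed.

(** Morphisms to [S = S] are functionals on [mon0], those to [w : S -> S] functionals on [mon1].
    Both extend along [u], and [bY] carries the second kind to [mon0 Y]. *)
Lemma std_injective : injective_obj (std : MonCat w).
Proof.
move=> X Y Z u v [uv1 uv0] h.
have [bY bYE] := mon_back_exists Y; have [bX bXE] := mon_back_exists X.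
have h1l : linear (fun x => rsubmx (lin_fun (mh1 h) x : F)).
  by move=> c x y; rewrite -linearP; congr rsubmx; exact: (linearP (mh1 h : {linear _ -> F})).
have h0l : linear (fun x => lsubmx (lin_fun (mh0 h) x : F)).
  by move=> c x y; rewrite -linearP; congr lsubmx; exact: (linearP (mh0 h : {linear _ -> F})).
have [r rE] := linear_of_fun h1l; have [l lE] := linear_of_fun h0l.
have [al alE] := gproj_conflation_extends Sn uv0 l.
have [be beE] := gproj_conflation_extends Sn uv1 r.
have [k0 k0E] := @linear_of_fun S (mon0 Y) F (fun y => row_mx (al y) (be (bY y)))
   ltac:(by move=> c x y; rewrite /= !linearP /= scale_row_mx add_row_mx).
have [|k kE] := @monHom_exists Y std k0.
  move=> x; exists (row_mx (al (mon_in Y x)) (be x)).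
  by rewrite k0E (mon_back_in bYE) /mon_in /= /std_fun row_mxKl row_mxKr linearZ.
exists k; apply: monHom_eq => x.
rewrite -[LHS]/(lin_fun (mh0 k) (lin_fun (mh0 u) x)) kE k0E.
have -> : bY (lin_fun (mh0 u) x) = lin_fun (mh1 u) (bX x).
  by apply: (@mon_in_inj Y); rewrite bYE -mh_in bXE lin_funZ.
rewrite [al _]alE [be _]beE lE rE -[RHS]hsubmxK; congr row_mx.
apply: (scale_w_inj w_reg).
have := mh_in h (bX x); rewrite bXE lin_funZ /mon_in /= /std_fun.
by move/(congr1 (@rsubmx _ _ _ _)); rewrite row_mxKr linearZ => <-.
Qed.

End Std.

(** Generators of [mon1 X] give the copies of [S = S], those of [mon0 X] the copies of [w : S -> S];
    each group makes one component surjective. *)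
Lemma mon_cover (X : mon w) : exists (a b : nat) (L : mon w)
  (i : monHom L (std a b)) (q : monHom (std a b) X),
  short_exact (lin_fun (mh1 i)) (lin_fun (mh1 q)) /\
  short_exact (lin_fun (mh0 i)) (lin_fun (mh0 q)).
Proof.
have /fgP[a [p1 p1s]] := gmod_fg (mon1 X).
have /fgP[b [p0 p0s]] := gmod_fg (mon0 X).
have [k kE] := mon_back_exists X.
have [q0 q0E] := @linear_of_fun S 'rV[S]_(a + b) (mon0 X)
   (fun z => mon_in X (p1 (lsubmx z)) + p0 (rsubmx z))
   ltac:(by move=> c x y; rewrite /= !linearP /= scalerDr addrACA).
have [q1 q1E] := @linear_of_fun S 'rV[S]_(a + b) (mon1 X)
   (fun z => p1 (lsubmx z) + k (p0 (rsubmx z)))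
   ltac:(by move=> c x y; rewrite /= !linearP /= scalerDr addrACA).
have q01 z : mon_in X (q1 z) = q0 (std_fun z).
  by rewrite q1E q0E /std_fun row_mxKl row_mxKr linearD kE !linearZ.
have [L1 [i1 [i1i i1E]]] := kernel_exists q1.
have [L0 [i0 [i0i i0E]]] := kernel_exists q0.
have iq1 : short_exact i1 q1.
  split=> // x; have [y <-] := p1s x; exists (row_mx y 0).
  by rewrite q1E row_mxKl row_mxKr !linear0 addr0.
have iq0 : short_exact i0 q0.
  split=> // x; have [y <-] := p0s x; exists (row_mx 0 y).
  by rewrite q0E row_mxKl row_mxKr !linear0 add0r.
have [m mE] : exists m : {linear L1 -> L0}, forall x, i0 (m x) = std_fun (i1 x).
  apply: (factor_inj (g := (@std_fun a b : {linear _ -> _}) \o i1)) => // x.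
  by apply/i0E; rewrite /= -q01 (short_exact_comp0 iq1) linear0.
have mi : injective m.
  by move=> x y xy; apply/i1i/std_fun_inj; rewrite -!mE xy.
(* The preimage of [w *: i0 y] under [std_fun] is explicit, and injectivity of [mon_in X] puts it in
   the kernel of [q1]. *)
have mc y : exists x, m x = w *: y.
  have [x xE] : exists x, i1 x = row_mx (w *: lsubmx (i0 y)) (rsubmx (i0 y)).
    apply/i1E/(@mon_in_inj X); rewrite q01 std_fun_w linearZZ.
    by rewrite (short_exact_comp0 iq0) scaler0 linear0.
  by exists x; apply: i0i; rewrite mE xE std_fun_w linearZ.
pose L := @Mon S w (gproj_of (syzygy_gorenstein Sn iq1 (gprojP _)))
  (gproj_of (syzygy_gorenstein Sn iq0 (gprojP _))) (m : linHom L1 L0) mi mc.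
have ci : lin_comp (mon_map (std a b)) (i1 : linHom L1 'rV[S]_(a + b)) =
    lin_comp (i0 : linHom L0 'rV[S]_(a + b)) (mon_map L).
  by apply: linHomP => x; rewrite -[RHS]/(i0 (m x)) mE.
have cq : lin_comp (mon_map X) (q1 : linHom 'rV[S]_(a + b) _) =
    lin_comp (q0 : linHom 'rV[S]_(a + b) _) (mon_map (std a b)).
  by apply: linHomP => x; exact: q01.
exists a, b, L, (@MonHom S w L (std a b) _ _ ci), (@MonHom S w (std a b) X _ _ cq).
by [].
Qed.

(** The embedding combines functionals on [mon0 X] and on [mon1 X], by the description of morphisms
    to [std]. The substance is that the map [m] between the cokernels is injective. *)
Lemma mon_hull (X : mon w) : exists (a b : nat) (Z : mon w)
  (i : monHom X (std a b)) (q : monHom (std a b) Z),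
  short_exact (lin_fun (mh1 i)) (lin_fun (mh1 q)) /\
  short_exact (lin_fun (mh0 i)) (lin_fun (mh0 q)).
Proof.
have [a [s [si se]]] := gorenstein_embedding Sn (gprojP (mon0 X)).
have [b [t [ti te]]] := gorenstein_embedding Sn (gprojP (mon1 X)).
have [k kE] := mon_back_exists X; have kI := mon_back_in kE.
have [j0 j0E] := @linear_of_fun S (mon0 X) 'rV[S]_(a + b)
   (fun x => row_mx (s x) (t (k x)))
   ltac:(by move=> c x y; rewrite /= !linearP /= scale_row_mx add_row_mx).
have [j1 j1E] := @linear_of_fun S (mon1 X) 'rV[S]_(a + b)
   (fun x => row_mx (s (mon_in X x)) (t x))
   ltac:(by move=> c x y; rewrite /= !linearP /= scale_row_mx add_row_mx).
have j01 x : std_fun (j1 x) = j0 (mon_in X x).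
  by rewrite j1E j0E /std_fun row_mxKl row_mxKr kI linearZ.
have j0i : injective j0 by move=> x y; rewrite !j0E => /eq_row_mx[/si].
have j1i : injective j1 by move=> x y; rewrite !j1E => /eq_row_mx[_ /ti].
have [dl dlE] := @linear_of_fun S 'rV[S]_(a + b) 'rV[S]_a (@lsubmx _ _ _ _)
   ltac:(by move=> c x y; rewrite linearP).
have [dr drE] := @linear_of_fun S 'rV[S]_(a + b) 'rV[S]_b (@rsubmx _ _ _ _)
   ltac:(by move=> c x y; rewrite linearP).
have [|Z0 [v0 [jv0 GZ0]]] := cosyzygy_gorenstein Sn (gprojP (mon0 X)) j0i.
  move=> f; have [g gE] := se f.
  exists ((g : {linear _ -> _}) \o dl : {linear _ -> _}) => x.
  by rewrite -gE -[LHS]/(lin_fun g (dl (j0 x))) dlE j0E row_mxKl.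
have [|Z1 [v1 [jv1 GZ1]]] := cosyzygy_gorenstein Sn (gprojP (mon1 X)) j1i.
  move=> f; have [g gE] := te f.
  exists ((g : {linear _ -> _}) \o dr : {linear _ -> _}) => x.
  by rewrite -gE -[LHS]/(lin_fun g (dr (j1 x))) drE j1E row_mxKr.
(* The cokernel [Z'] of [t] is Gorenstein projective, hence has no [w]-torsion; this allows division
   by [w] modulo the image of [t]. *)
have [Z' [v' [[_ v'E _] GZ']]] := cosyzygy_gorenstein Sn (gprojP (mon1 X)) ti te.
have [_ v1E v1s] := jv1; have [_ v0E v0s] := jv0.
have [x|m mE] := factor_surj (v := v1) (g := v0 \o (@std_fun a b : {linear _ -> _})) v1s.
  by move=> /v1E[y <-]; rewrite /= j01; apply/v0E; exists (mon_in X y).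
(* Let [std_fun y = j0 x]. Then [w] times the right half of [y] is [t (k x)], so that half is some
   [t g]. Cancelling [w] gives [x = mon_in X g], whence [y = j1 g], which is zero in [Z1]. *)
have mi : injective m.
  move=> x1 x2 /eqP; rewrite -subr_eq0 -linearB.
  move: (x1 - x2) (subr0_eq (x := x1) (y := x2)).
  move=> z e /eqP mz; apply: e; have [y yE] := v1s z; move: mz; rewrite -yE mE /=.
  move=> /v0E[x]; rewrite j0E /std_fun => /eq_row_mx[xl xr].
  have [g gE] : exists g, t g = rsubmx y.
    apply/v'E/(gorenstein_torsion_free Sn w_reg GZ'); rewrite -linearZ -xr.
    by apply/v'E; exists (k x).
  have kx : k x = w *: g by apply: ti; rewrite xr -gE linearZ.
  have xg : x = mon_in X g.
    apply/eqP; rewrite -subr_eq0; apply/eqP.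
    apply: (gorenstein_torsion_free Sn w_reg (gprojP (mon0 X))).
    by rewrite scalerBr -kE kx linearZ subrr.
  by apply/v1E; exists g; rewrite j1E gE -xg xl hsubmxK.
have mc z : exists x, m x = w *: z.
  have [y <-] := v0s z; exists (v1 (row_mx (w *: lsubmx y) (rsubmx y))).
  by rewrite mE /= std_fun_w linearZ.
pose Z := @Mon S w (gproj_of GZ1) (gproj_of GZ0) (m : linHom Z1 Z0) mi mc.
have ci : lin_comp (mon_map (std a b)) (j1 : linHom _ 'rV[S]_(a + b)) =
    lin_comp (j0 : linHom _ 'rV[S]_(a + b)) (mon_map X).
  by apply: linHomP => x; exact: j01.
have cq : lin_comp (mon_map Z) (v1 : linHom 'rV[S]_(a + b) _) =
    lin_comp (v0 : linHom 'rV[S]_(a + b) _) (mon_map (std a b)).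
  by apply: linHomP => x; exact: mE.
exists a, b, Z, (@MonHom S w X (std a b) _ _ ci), (@MonHom S w (std a b) Z _ _ cq).
by [].
Qed.

Lemma mon_projective_retract (X : mon w) : projective (X : MonCat w) ->
  exists a b (s : monHom X (std a b)) (r : monHom (std a b) X),
    mh_comp r s = mh_id X.
Proof.
move=> pX; have [a [b [L [i [q iq]]]]] := mon_cover X.
have [s sE] := pX _ _ _ i q iq (idm (X : MonCat w)).
by exists a, b, s, q.
Qed.

Lemma MonCat_frobenius : frobenius_like (MonCat w).
Proof.
split.
- move=> X Y Z u v [_ uv]; apply: monHom_eq => x.
  exact: (short_exact_comp0 (f := (mh0 u : {linear _ -> _}))
    (g := (mh0 v : {linear _ -> _})) uv).
- move=> X Y Z W u v g [_ [_ _ vs]] gv; apply: monHom_eq => z.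
  by have [y <-] := vs z; exact: (congr1 (fun h => lin_fun (mh0 h) y) gv).
- move=> X Y Z W u v g [[_ _ v1s] [_ u0E v0s]] gu.
  have [y|h hE] := factor_surj (v := (mh0 v : {linear mon0 Y -> mon0 Z}))
    (g := (mh0 g : {linear mon0 Y -> mon0 W})) v0s.
    by move=> /u0E[x <-]; exact: (congr1 (fun h => lin_fun (mh0 h) x) gu).
  have [|k kE] := @monHom_exists Z W h.
    move=> z; have [y <-] := v1s z; exists (lin_fun (mh1 g) y).
    by rewrite -mh_in -mh_in [RHS]hE.
  by exists k; apply: monHom_eq => y;
    rewrite -[LHS]/(lin_fun (mh0 k) (lin_fun (mh0 v) y)) kE hE.
- move=> P /mon_projective_retract[a [b [s [r rs]]]].
  exact: (retract_injective (C := MonCat w) rs (@std_injective a b)).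
- move=> X; have [a [b [Z [i [q iq]]]]] := mon_hull X.
  by exists (std a b), Z, i, q; split=> //; exact: std_projective.
Qed.

End Mon.

(** * Presentations by objects of Mon *)

Section MonPresentations.
Variables (S R : comNzRingType) (phi : {rmorphism S -> R}) (w : S).
Hypotheses (phi_surj : forall r, exists s, phi s = r)
  (phi_ker : forall s, phi s = 0 <-> exists a, s = a * w)
  (w_reg : nonzerodivisor w) (Sn : noetherian S).

Local Notation "x ^r" := (map_mx phi x) (at level 2, format "x ^r").
Let Rn : noetherian R := noetherian_quotient phi_surj Sn.

Record mon_pres (M : gproj R) := MonPres {
  mp_rank : nat;
  mp_map : {linear 'rV[R]_mp_rank -> M};
  mp_ker : lmodType S;
  mp_in : {linear mp_ker -> 'rV[S]_mp_rank};
  mp_presents : presents phi mp_in mp_map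
}.

Section Object.
Variables (M : gproj R) (p : mon_pres M).

Lemma mp_in_inj : injective (mp_in p).
Proof. by case: (mp_presents p). Qed.

Lemma mp_inP x : mp_map p x^r = 0 <-> exists k, mp_in p k = x.
Proof. by case: (mp_presents p). Qed.

Lemma mp_surj y : exists x, mp_map p x = y.
Proof. by case: (mp_presents p). Qed.

Lemma mp_red_surj y : exists x, mp_map p x^r = y.
Proof.
by have [z <-] := mp_surj y; have [x <-] := red_surj phi_surj z; exists x.
Qed.

Lemma mp_coker y : exists x, mp_in p x = w *: y.
Proof.
by have [f fE] := presents_w phi_ker (mp_presents p); exists (f y).
Qed.

Definition mp_gorenstein : fg_gorenstein (mp_ker p) :=
  presented_gorenstein phi_surj phi_ker w_reg Sn (mp_presents p) (gprojP M).

Definition mp_obj : mon w :=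
  @Mon S w (gproj_of mp_gorenstein) (gproj_free S (mp_rank p))
    (mp_in p : linHom _ _) mp_in_inj mp_coker.

End Object.

Definition mp_covers (M N : gproj R) (p : mon_pres M) (q : mon_pres N)
    (f : monHom (mp_obj p) (mp_obj q)) (h : linHom M N) : Prop :=
  forall x : 'rV[S]_(mp_rank p),
    mp_map q (lin_fun (mh0 f) x : 'rV[S]_(mp_rank q))^r = lin_fun h (mp_map p x^r).

Lemma mp_covers_exists (M N : gproj R) (p : mon_pres M) (q : mon_pres N)
    (f0 : {linear 'rV[S]_(mp_rank p) -> 'rV[S]_(mp_rank q)}) (h : linHom M N) :
  (forall x, mp_map q (f0 x)^r = lin_fun h (mp_map p x^r)) ->
  exists f : monHom (mp_obj p) (mp_obj q),
    (forall x, lin_fun (mh0 f) x = f0 x) /\ mp_covers f h.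
Proof.
move=> f0E; have [x|f fE] := @monHom_exists S w (mp_obj p) (mp_obj q) f0.
  have /mp_inP : mp_map q (f0 (mp_in p x))^r = 0.
    by rewrite f0E (_ : mp_map p _ = 0) ?lin_fun0 //; apply/mp_inP; exists x.
  exact.
by exists f; split=> // x; rewrite fE f0E.
Qed.

Lemma mp_covers_lift (M N : gproj R) (p : mon_pres M) (q : mon_pres N)
    (h : linHom M N) : exists f : monHom (mp_obj p) (mp_obj q), mp_covers f h.
Proof.
have [x|g gE] := free_lift (g := mp_map q)
  (h := (h : {linear _ -> _}) \o mp_map p : {linear _ -> _}); first exact: mp_surj.
have [f0 f0E] := lift_linear phi_surj g.
have [|f [_ fE]] := @mp_covers_exists _ _ p q f0 h; last by exists f.
by move=> x; rewrite f0E gE.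
Qed.

Lemma mp_covers_induced (M N : gproj R) (p : mon_pres M) (q : mon_pres N)
    (f : monHom (mp_obj p) (mp_obj q)) : exists h, mp_covers f h.
Proof.
pose f0 := (mh0 f : {linear 'rV[S]_(mp_rank p) -> 'rV[S]_(mp_rank q)}).
have [g gE] := reduce_linear phi f0.
have [y yK|h hE] := factor_surj (g := mp_map q \o g : {linear _ -> _}) (@mp_surj _ p).
  have [x xE] := red_surj phi_surj y; rewrite /= -xE gE.
  have /mp_inP[k kE] : mp_map p x^r = 0 by rewrite xE.
  apply/mp_inP; exists (lin_fun (mh1 f) k).
  by rewrite -[LHS]/(mon_in (mp_obj q) (lin_fun (mh1 f) k)) -mh_in -kE.
by exists h => x; rewrite -gE; exact: esym (hE _).
Qed.

Lemma mp_covers_zero (M N : gproj R) (p : mon_pres M) (q : mon_pres N)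
    (f : monHom (mp_obj p) (mp_obj q)) :
  mp_covers f 0 -> stable_eq (f : hom (mp_obj p : MonCat w) (mp_obj q)) 0.
Proof.
move=> f0; set n := mp_rank p.
(* [std w_reg n 0] contains no copy of [w : S -> S]; it is [S^n = S^n] written with [n + 0]
   columns. *)
have [g gE] := @linear_of_fun S 'rV[S]_n 'rV[S]_(n + 0) (fun x => row_mx x 0)
  ltac:(by move=> c x y; rewrite /= scale_row_mx add_row_mx scaler0 addr0).
pose f' := (mh0 f : {linear 'rV[S]_n -> 'rV[S]_(mp_rank q)}).
have [h hE] := @linear_of_fun S 'rV[S]_(n + 0) 'rV[S]_(mp_rank q) (fun x => f' (lsubmx x))
  ltac:(by move=> c x y; rewrite /= !linearP).
have [x|a aE] := @monHom_exists S w (mp_obj p) (std w_reg n 0) g.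
  exists (g (mon_in (mp_obj p) x)).
  by rewrite gE /mon_in /= /std_fun row_mxKl row_mxKr scaler0.
have [x|b bE] := @monHom_exists S w (std w_reg n 0) (mp_obj q) h.
  (* As [f] induces zero, its component on [mon0] takes all of [S^n], not only the image of
     [mp_in p], into the image of [mp_in q]. *)
  have /mp_inP : mp_map q (h (std_fun w x))^r = 0 by rewrite hE f0.
  exact.
exists (std w_reg n 0); split; first exact: std_projective.
exists a, b; rewrite subr0; apply: monHom_eq => x.
by rewrite -[RHS]/(lin_fun (mh0 b) (lin_fun (mh0 a) x)) aE bE gE hE row_mxKl.
Qed.

Lemma mp_covers_uniq (M N : gproj R) (p : mon_pres M) (q : mon_pres N)
    (f : monHom (mp_obj p) (mp_obj q)) h h' :
  mp_covers f h -> mp_covers f h' -> h = h'.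
Proof.
move=> c c'; apply: linHomP => y; have [x <-] := mp_red_surj p y.
by rewrite -c -c'.
Qed.

Lemma mp_exists (M : gproj R) : inhabited (mon_pres M).
Proof.
have /fgP[n [p ps]] := gmod_fg M; have [K [j jp]] := presents_exists phi ps.
by constructor; exact: MonPres jp.
Qed.

(* The horseshoe lemma. *)
Lemma mp_conflation (M N L : gproj R) (u : linHom M N) (v : linHom N L) :
  short_exact (lin_fun u) (lin_fun v) -> forall (p : mon_pres M) (r : mon_pres L),
  exists (q : mon_pres N) (u' : monHom (mp_obj p) (mp_obj q))
    (v' : monHom (mp_obj q) (mp_obj r)),
    [/\ conflation (u' : hom (mp_obj p : MonCat w) (mp_obj q)) v',
        mp_covers u' u & mp_covers v' v].
Proof.
move=> uv p r; have [ui uE vs] := uv.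
have vu x : lin_fun v (lin_fun u x) = 0 by apply/uE; exists x.
set m := mp_rank p; set n := mp_rank r.
have [la laE] := free_lift (g := (v : {linear N -> L})) (h := mp_map r) (fun x => vs _).
pose mu : {linear 'rV[R]_m -> N} := (u : {linear M -> N}) \o mp_map p.
have [t tE] := @linear_of_fun R 'rV[R]_(m + n) N
  (fun z => mu (lsubmx z) + la (rsubmx z))
  ltac:(by move=> c x y; rewrite /= !linearP /= scalerDr addrACA).
have vt z : lin_fun v (t z) = mp_map r (rsubmx z).
  by rewrite tE lin_funD [lin_fun v (mu _)]vu add0r; exact: laE.
have ts y : exists x, t x = y.
  have [c cE] := mp_surj r (lin_fun v y).
  have [z zE] : exists z, lin_fun u z = y - la c.
    apply/uE; rewrite [LHS](linearB (v : {linear N -> L})).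
    by rewrite [X in _ - X](laE c) cE subrr.
  have [b bE] := mp_surj p z; exists (row_mx b c).
  by rewrite tE row_mxKl row_mxKr /mu /= bE [X in X + _]zE subrK.
have [K [j jt]] := presents_exists phi ts; pose q := MonPres jt.
have [iu iuE] := @linear_of_fun S 'rV[S]_m 'rV[S]_(m + n) (fun x => row_mx x 0)
  ltac:(by move=> c x y; rewrite /= scale_row_mx add_row_mx scaler0 addr0).
have [pv pvE] := @linear_of_fun S 'rV[S]_(m + n) 'rV[S]_n (@rsubmx _ _ _ _)
  ltac:(by move=> c x y; rewrite linearP).
have [x|u' [u'E cu]] := @mp_covers_exists M N p q iu u.
  by rewrite iuE map_row_mx map_mx0 /= tE row_mxKl row_mxKr linear0 addr0.
have [x|v' [v'E cv]] := @mp_covers_exists N L q r pv v.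
  by rewrite pvE map_rsubmx /= vt.
exists q, u', v'; split=> //.
have e0 : short_exact (lin_fun (mh0 u')) (lin_fun (mh0 v')).
  split=> [x y|y|z].
  - by rewrite !u'E !iuE => /eq_row_mx[].
  - rewrite v'E pvE; split=> [y0|[x <-]].
      by exists (lsubmx y); rewrite u'E iuE -[X in row_mx _ X]y0; exact: hsubmxK.
    by rewrite u'E iuE row_mxKr.
  - by exists (row_mx 0 z); rewrite v'E pvE row_mxKr.
have [u0i u0E _] := e0.
split=> //; split=> [x y xy|y|z].
- by apply/(@mp_in_inj _ p)/u0i; rewrite -![mp_in p _]/(mon_in (mp_obj p) _) !mh_in xy.
- split=> [vy|[x <-]].
    have /u0E[x xE] : lin_fun (mh0 v') (mon_in (mp_obj q) y) = 0.
      by rewrite mh_in vy linear0.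
    have [k kE] : exists k, mp_in p k = x.
      have qy : mp_map q (mp_in q y)^r = 0 by apply/mp_inP; exists y.
      apply/mp_inP/ui; rewrite -(cu x) xE lin_fun0; exact: qy.
    exists k; apply: (@mp_in_inj _ q).
    by rewrite -[LHS]/(mon_in (mp_obj q) _) -mh_in -[RHS]xE -kE.
  apply: (@mp_in_inj _ r); rewrite linear0 -[LHS]/(mon_in (mp_obj r) _) -!mh_in.
  by apply/u0E; exists (mon_in (mp_obj p) x).
(* [la] takes the reduction of [c] into the image of [u], and [b] corrects it so that [row_mx b c]
   lies in the kernel presenting [N]. *)
- pose c := mp_in r z; have [d dE] : exists d, lin_fun u d = - la c^r.
    apply/uE; rewrite [LHS](linearN (v : {linear N -> L})) [X in - X](laE c^r).
    by rewrite (iffRL (mp_inP _)) ?oppr0 //; exists z.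
  have [b bE] := mp_red_surj p d.
  have [k kE] : exists k, mp_in q k = row_mx b c.
    have [_ tK _] := jt; apply/tK; rewrite map_row_mx tE row_mxKl row_mxKr /mu /= bE.
    by rewrite [X in X + _]dE addNr.
  exists k; apply: (@mp_in_inj _ r).
  rewrite -[LHS]/(mon_in (mp_obj r) _) -mh_in -[mon_in _ _]/(mp_in q k) kE v'E pvE.
  by rewrite row_mxKr.
Qed.

(** In [S^(a + b)] the image of [std_fun] is the kernel of the projection to [R^b]: each copy of
    [S = S] has cokernel zero, each copy of [w : S -> S] has cokernel [R]. Both isomorphisms are the
    identity on [S^(a + b)]. *)
Lemma mp_std a b : exists (q : mon_pres (gproj_free R b))
  (s : monHom (mp_obj q) (std w_reg a b)) (r : monHom (std w_reg a b) (mp_obj q)),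
  mh_comp r s = mh_id _ /\ mh_comp s r = mh_id _.
Proof.
have [p pE] := @linear_of_fun R 'rV[R]_(a + b) (gproj_free R b) (@rsubmx _ _ _ _)
  ltac:(by move=> c x y; rewrite linearP).
have [y|K [j jp]] := presents_exists phi (p := p).
  by exists (row_mx 0 y); rewrite pE row_mxKr.
have [i iE] := @linear_of_fun S 'rV[S]_(a + b) 'rV[S]_(a + b) id (fun _ _ _ => erefl).
have [_ jK _] := jp; exists (MonPres jp).
have [x|s sE] := @monHom_exists S w (mp_obj (MonPres jp)) (std w_reg a b) i.
  have pj : p (j x)^r = 0 by apply/jK; exists x.
  have [|z zE] := red_ker phi_ker (x := rsubmx (j x)).
    by rewrite map_rsubmx -pE.
  exists (row_mx (lsubmx (j x)) z); rewrite iE.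
  by rewrite [LHS]/(std_fun w _) /std_fun row_mxKl row_mxKr zE; exact: hsubmxK.
have [x|r rE] := @monHom_exists S w (std w_reg a b) (mp_obj (MonPres jp)) i.
  have /jK : p (std_fun w x)^r = 0.
    by rewrite pE /std_fun map_row_mx row_mxKr (red_map_w phi_ker).
  by rewrite iE.
exists s, r; split; apply: monHom_eq => x.
  by rewrite -[LHS]/(lin_fun (mh0 r) (lin_fun (mh0 s) x)) sE rE !iE.
by rewrite -[LHS]/(lin_fun (mh0 s) (lin_fun (mh0 r) x)) rE sE !iE.
Qed.

Lemma mp_cover (M : gproj R) : exists (K P : gproj R) (u : linHom K P) (v : linHom P M),
  short_exact (lin_fun u) (lin_fun v) /\
  exists q : mon_pres P, projective (mp_obj q : MonCat w).
Proof.
have [K [n [u [v uv]]]] := gproj_free_cover Rn M.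
exists K, (gproj_free R n), u, v; split=> //.
have [q [s [r [rs _]]]] := mp_std 0 n; exists q.
exact: (retract_projective (C := MonCat w) rs (@std_projective S w w_reg 0 n)).
Qed.

Lemma mp_projective (X : mon w) : projective (X : MonCat w) ->
  exists (P : gproj R) (q : mon_pres P) (s : monHom X (mp_obj q))
    (r : monHom (mp_obj q) X),
    projective (P : GprojCat R) /\ mh_comp r s = mh_id X.
Proof.
move=> /(mon_projective_retract w_reg Sn)[a [b [s [r rs]]]].
have [q [s' [r' [_ sr]]]] := mp_std a b.
exists (gproj_free R b), q, (mh_comp r' s), (mh_comp r s').
split; first exact: gproj_free_projective.
by rewrite -mh_compA (mh_compA s') sr mh_comp1m.
Qed.

Definition mon_presentations : presentations (GprojCat R) (MonCat w).
Proof.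
apply: (@Presentations (GprojCat R) (MonCat w) mon_pres mp_obj mp_covers).
- by [].
- by move=> L M N p q r g f k h gk fh x; rewrite gk fh.
- move=> M N p q f f' h h' fh fh' x.
  by rewrite -[RHS]/(lin_fun h _ + lin_fun h' _) -fh -fh' -linearD -map_mxD.
- move=> M N p q f h fh x.
  by rewrite -[RHS]/(- lin_fun h _) -fh -linearN -map_mxN.
- exact: mp_covers_uniq.
- exact: mp_covers_induced.
- exact: mp_covers_lift.
- exact: mp_covers_zero.
- exact: mp_exists.
- exact: mp_conflation.
- exact: mp_cover.
- exact: mp_projective.
Defined.

Lemma gproj_to_mon_functor (sG : happel_shift (GprojCat R)) (sM : happel_shift (MonCat w)) :
  exists T : triangle_functor sG sM, fully_faithful T.
Proof.
exists (presented_functor (GprojCat_frobenius Rn) (MonCat_frobenius w_reg Sn)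
  mon_presentations sG sM).
exact: presented_functor_fully_faithful.
Qed.

End MonPresentations.

(** Happel's shifts depend on choices; they are shown to exist, so that the assertion for all
    choices is not vacuous. *)
Theorem theorem3p13 (S : comNzRingType) (n : set S) (w : S)
    (Snoeth : noetherian S) (Sloc : local_ring n)
    (nw : n w) (wreg : nonzerodivisor w) :
  let R := quotient_ring Sloc nw in
  inhabited (happel_shift (GprojCat R)) /\
  inhabited (happel_shift (MonCat w)) /\
  forall (sG : happel_shift (GprojCat R)) (sM : happel_shift (MonCat w)),
    exists T : triangle_functor sG sM, fully_faithful T.
Proof.
move=> R; pose I := principal_ideal (local_proper Sloc nw).
pose phi : {rmorphism S -> R} := (\pi_({ideal_quot I}))%qT.
have phi_surj r : exists s, phi s = r by exists (repr r); exact: reprK.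
have phi_ker s : phi s = 0 <-> exists a, s = a * w.
  have E : (phi s == phi 0) = (s \in I).
    by rewrite -{2}[s]subr0; exact: esym (Quotient.idealrBE _ s 0).
  rewrite -(rmorph0 phi); split=> [/eqP|sI]; first by rewrite E => /asboolP.
  by apply/eqP; rewrite E; apply/asboolP.
split; first exact/frobenius_happel_shift/GprojCat_frobenius/(noetherian_quotient phi_surj).
split; first exact/frobenius_happel_shift/MonCat_frobenius.
exact: (gproj_to_mon_functor phi_surj phi_ker wreg Snoeth).
Qed.
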